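(* Let $\Lambda$ be a finite connected triangle-free simplicial graph with at least one edge. Then the intersection complex $|I(X(\Lambda))|$ is a quasi-tree, i.e. quasi-isometric to a tree. In particular, $A(\Lambda)$ is weakly hyperbolic relative to $\{A(\Lambda')\mid \Lambda'\in\mathcal{J}(\Lambda)\}$.
   Context: $A(\Lambda)=\langle V(\Lambda)\mid [v,w]=1\text{ if }v,w\text{ adjacent}\rangle$ is the right-angled Artin group, $S(\Lambda)$ its Salvetti complex (one vertex, one loop for each vertex of $\Lambda$, one square torus for each edge of $\Lambda$), and $X(\Lambda)$ the universal cover of $S(\Lambda)$, a CAT(0) square complex whose vertices are identified with the elements of $A(\Lambda)$. A join subgraph of $\Lambda$ is a full subgraph $\Lambda_1=\Lambda_2\circ\Lambda_3$ that is the join of two non-empty subgraphs; $\mathcal{J}(\Lambda)$ is the collection of all join subgraphs of $\Lambda$. For a join subgraph $\Lambda_1$ and $g\in A(\Lambda)$, the standard product subcomplex of $X(\Lambda)$ determined by $g$ and $\Lambda_1$ is the full subcomplex spanned by the coset $gA(\Lambda_1)$ (a copy of $X(\Lambda_1)$, a product of two trees); it is a maximal product subcomplex if $\Lambda_1$ is a maximal join subgraph under inclusion. $|I(X(\Lambda))|$ is the simplicial complex whose vertices are the maximal product subcomplexes of $X(\Lambda)$, where $k+1$ vertices span a $k$-simplex iff the intersection of the corresponding maximal product subcomplexes contains a standard product subcomplex; it is given the path metric in which each simplex is a regular Euclidean simplex with edges of length $1$. A finitely generated group $G$ is weakly hyperbolic relative to a finite collection of subgroups $\{H_i\}$ if the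 graph obtained from a Cayley graph of $G$ (finite generating set) by coning off each left coset of each $H_i$ is Gromov hyperbolic. *)

(* Defs.v *)
From HB Require Import structures.
From mathcomp Require Import all_boot all_order all_algebra.
From mathcomp Require Import generic_quotient.
From mathcomp Require Import all_classical all_reals.
From mathcomp Require Import ereal.

Set Implicit Arguments.
Unset Strict Implicit.
Unset Printing Implicit Defensive.
Import Order.TTheory GRing.Theory Num.Theory.
Local Open Scope quotient_scope.
Local Open Scope classical_set_scope.
Local Open Scope ring_scope.

(* The letter (v, true) is the generator v, (v, false) is its inverse. *)
Definition letter (V : Type) : Type := (V * bool)%type.
Definition word (V : Type) : Type := seq (letter V).
Definition inv_letter (V : Type) (x : letter V) : letter V := (x.1, ~~ x.2).
Definition inv_word (V : Type) (w : word V) : word V :=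
  rev (map (@inv_letter V) w).

Inductive word_eqv (V : Type) (rels : set (word V)) : word V -> word V -> Prop :=
| word_eqv_refl u : word_eqv rels u u
| word_eqv_sym u v : word_eqv rels u v -> word_eqv rels v u
| word_eqv_trans u v w :
    word_eqv rels u v -> word_eqv rels v w -> word_eqv rels u w
| word_eqv_cancel u x v : word_eqv rels (u ++ [:: x; inv_letter x] ++ v) (u ++ v)
| word_eqv_rel u r v : rels r -> word_eqv rels (u ++ r ++ v) (u ++ v).

Section Presented.
Variables (V : choiceType) (rels : set (word V)).

Definition word_eqvb : rel (seq (V * bool)) := fun u v => `[< word_eqv rels u v >].

Lemma word_eqvb_refl : reflexive word_eqvb.
Proof. by move=> u; apply/asboolP; constructor. Qed.

Lemma word_eqvb_sym : symmetric word_eqvb.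
Proof.
by move=> u v; apply/idP/idP => /asboolP h; apply/asboolP; apply: word_eqv_sym.
Qed.

Lemma word_eqvb_trans : transitive word_eqvb.
Proof.
move=> v u w /asboolP uv /asboolP vw; apply/asboolP.
exact: word_eqv_trans vw.
Qed.

Canonical word_equiv :=
  EquivRel word_eqvb word_eqvb_refl word_eqvb_sym word_eqvb_trans.

Definition presented : Type := {eq_quot word_equiv}.
HB.instance Definition _ := Choice.on presented.

Definition word_class (w : word V) : presented :=
  (\pi_({eq_quot word_equiv}) w)%qT.

Lemma word_classP (u v : word V) :
  word_class u = word_class v <-> word_eqv rels u v.
Proof.
split; first by move/eqP; rewrite /word_class piE => /asboolP.
by move=> h; apply/eqP; rewrite /word_class piE; apply/asboolP.
Qed.

Lemma word_class_repr (g : presented) : word_class (repr g) = g.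
Proof. by rewrite /word_class reprK. Qed.

Lemma word_eqv_catl (p u v : word V) :
  word_eqv rels u v -> word_eqv rels (p ++ u) (p ++ v).
Proof.
elim=> {u v} [u|u v _ ih|u v w _ ih1 _ ih2|u x v|u r v rr].
- by constructor.
- exact: word_eqv_sym.
- exact: word_eqv_trans ih1 ih2.
- by rewrite !(catA p); constructor.
- by rewrite !(catA p); constructor.
Qed.

Lemma word_eqv_catr (p u v : word V) :
  word_eqv rels u v -> word_eqv rels (u ++ p) (v ++ p).
Proof.
elim=> {u v} [u|u v _ ih|u v w _ ih1 _ ih2|u x v|u r v rr].
- by constructor.
- exact: word_eqv_sym.
- exact: word_eqv_trans ih1 ih2.
- by rewrite -!catA; constructor.
- by rewrite -!catA; constructor.
Qed.

Lemma word_eqv_cat (u u' v v' : word V) :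
  word_eqv rels u u' -> word_eqv rels v v' -> word_eqv rels (u ++ v) (u' ++ v').
Proof.
move=> uu vv; apply: word_eqv_trans (word_eqv_catr v uu) _.
exact: word_eqv_catl.
Qed.

Lemma inv_letterK : involutive (@inv_letter V).
Proof. by case=> v b; rewrite /inv_letter negbK. Qed.

Lemma inv_wordK : involutive (@inv_word V).
Proof.
by move=> u; rewrite /inv_word map_rev revK -map_comp map_id_in// => x _ /=;
  rewrite inv_letterK.
Qed.

Lemma word_eqv_mulV (u : word V) : word_eqv rels (u ++ inv_word u) [::].
Proof.
elim: u => [|x u ih]; first by constructor.
rewrite /inv_word /= rev_cons -cats1.
apply: word_eqv_trans (word_eqv_cancel rels [::] x [::]).
apply: (@word_eqv_catl [:: x] _ [:: inv_letter x]).
rewrite catA; exact: (word_eqv_catr [:: inv_letter x] ih).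
Qed.

Lemma word_eqv_Vmul (u : word V) : word_eqv rels (inv_word u ++ u) [::].
Proof. by have := word_eqv_mulV (inv_word u); rewrite inv_wordK. Qed.

Lemma word_eqv_inv (u v : word V) :
  word_eqv rels u v -> word_eqv rels (inv_word u) (inv_word v).
Proof.
move=> uv.
have h1 : word_eqv rels (inv_word u) (inv_word u ++ (v ++ inv_word v)).
  apply: word_eqv_sym; rewrite -[X in word_eqv _ _ X]cats0.
  exact/word_eqv_catl/word_eqv_mulV.
apply: (word_eqv_trans h1); rewrite catA.
rewrite -[X in word_eqv _ _ X]cat0s.
apply: word_eqv_catr; apply: word_eqv_trans (word_eqv_Vmul u).
exact/word_eqv_catl/word_eqv_sym.
Qed.

Definition pres_one : presented := word_class [::].
Definition pres_mul (g h : presented) : presented :=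
  word_class (repr g ++ repr h).
Definition pres_inv (g : presented) : presented :=
  word_class (inv_word (repr g)).

Lemma word_eqv_repr (u : word V) : word_eqv rels (repr (word_class u)) u.
Proof. by apply/word_classP; rewrite word_class_repr. Qed.

Lemma pres_mulE (u v : word V) :
  pres_mul (word_class u) (word_class v) = word_class (u ++ v).
Proof. by apply/word_classP/word_eqv_cat; exact: word_eqv_repr. Qed.

Lemma pres_invE (u : word V) :
  pres_inv (word_class u) = word_class (inv_word u).
Proof. by apply/word_classP/word_eqv_inv/word_eqv_repr. Qed.

Lemma pres_mulA : associative pres_mul.
Proof.
move=> a b c; rewrite -(word_class_repr a) -(word_class_repr b).
by rewrite -(word_class_repr c) !pres_mulE catA.
Qed.

Lemma pres_mul1 : left_id pres_one pres_mul.
Proof. by move=> a; rewrite -(word_class_repr a) pres_mulE. Qed.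

Lemma pres_1mul : right_id pres_one pres_mul.
Proof. by move=> a; rewrite -(word_class_repr a) pres_mulE cats0. Qed.

Lemma pres_Vmul : left_inverse pres_one pres_inv pres_mul.
Proof.
move=> a; rewrite -(word_class_repr a) pres_invE pres_mulE.
exact/word_classP/word_eqv_Vmul.
Qed.

Lemma pres_mulV : right_inverse pres_one pres_inv pres_mul.
Proof.
move=> a; rewrite -(word_class_repr a) pres_invE pres_mulE.
exact/word_classP/word_eqv_mulV.
Qed.

HB.instance Definition _ := isGroup.Build presented
  pres_mulA pres_mul1 pres_1mul pres_Vmul pres_mulV.

End Presented.

Definition subgroup (G : groupType) : set (set G) :=
  [set H | [/\ H 1%g, forall x y, H x -> H y -> H (x * y)%g
             & forall x, H x -> H (x^-1)%g]].

Definition gen (G : groupType) (S : set G) : set G := smallest (@subgroup G) S.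

Definition left_coset (G : groupType) (g : G) (H : set G) : set G :=
  [set (g * h)%g | h in H].

Lemma gen_subgroup (G : groupType) (S : set G) : subgroup (gen S).
Proof.
split=> [A [[A1 _ _] _] //|x y hx hy A AS|x hx A AS].
- by case: (AS) => -[_ AM _] _; apply: AM; [exact: hx|exact: hy].
- by case: (AS) => -[_ _ AV] _; apply: AV; exact: hx.
Qed.

Record scomplex (V : choiceType) := SComplex {
  simplex : set (set V);
  simplex_finite : forall s, simplex s -> finite_set s;
  simplex_nonempty : forall s, simplex s -> s !=set0;
  simplex_face : forall s t, simplex s -> t `<=` s -> t !=set0 -> simplex t;
  simplex_vertex : forall v, simplex [set v]
}.

Record realization (R : realType) (V : choiceType) (K : scomplex V) := Point {
  bary :> V -> R;
  bary_ge0 : forall v, 0 <= bary v;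
  bary_supp : simplex K [set v | bary v != 0];
  bary_sum : \sum_(v \in [set: V]) bary v = 1
}.

Section PathMetric.
Variables (R : realType) (V : choiceType) (K : scomplex V).
Implicit Types x y : realization R K.

Definition common_simplex x y : Prop :=
  exists2 s, simplex K s &
    [set v | x v != 0] `<=` s /\ [set v | y v != 0] `<=` s.

(* The simplex spanned by the points v / sqrt 2, for v in the standard basis,
   is regular with edges of length 1. *)
Definition simplex_dist x y : R :=
  Num.sqrt ((\sum_(v \in [set: V]) (x v - y v) ^+ 2) / 2).

(* Infimum of the lengths of the piecewise linear paths from x to y; it is +oo
   when x and y lie in distinct components. *)
Definition path_dist x y : \bar R :=
  ereal_inf [set l : \bar R | exists n (c : nat -> realization R K),
    [/\ c 0%N = x, c n = y,
        forall i, (i < n)%N -> common_simplex (c i) (c i.+1)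
      & l = (\sum_(i < n) simplex_dist (c i) (c i.+1))%:E]].

End PathMetric.

Section GraphComplex.
Variables (V : choiceType) (e : rel V).

Definition graph_simplex : set (set V) :=
  [set s | exists u v, (u = v \/ e u v) /\ s = [set u; v]].

Lemma graph_simplex_finite s : graph_simplex s -> finite_set s.
Proof. by move=> [u [v [_ ->]]]; exact: finite_set2. Qed.

Lemma graph_simplex_nonempty s : graph_simplex s -> s !=set0.
Proof. by move=> [u [v [_ ->]]]; exists u; left. Qed.

Lemma graph_simplex_vertex v : graph_simplex [set v].
Proof. by exists v, v; rewrite setUid; split=> //; left. Qed.

Lemma graph_simplex_face s t :
  graph_simplex s -> t `<=` s -> t !=set0 -> graph_simplex t.
Proof.
move=> [u [v [uv ->]]] ts [w tw].
have [tu|tu] := pselect (t u); have [tv|tv] := pselect (t v).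
- exists u, v; split=> //; apply/seteqP; split=> // x.
  by case=> [->|->].
- suff -> : t = [set u] by exact: graph_simplex_vertex.
  apply/seteqP; split=> x /=; last by move=> ->.
  by move=> tx; case: (ts _ tx) => // xv; rewrite xv in tx.
- suff -> : t = [set v] by exact: graph_simplex_vertex.
  apply/seteqP; split=> x /=; last by move=> ->.
  by move=> tx; case: (ts _ tx) => // xu; rewrite xu in tx.
- by case: (ts _ tw) => wE; rewrite wE in tw.
Qed.

Definition graph_complex : scomplex V :=
  SComplex graph_simplex_finite graph_simplex_nonempty graph_simplex_face
           graph_simplex_vertex.

End GraphComplex.

Definition quasi_isometric (R : realType) (X Y : Type)
    (dX : X -> X -> \bar R) (dY : Y -> Y -> \bar R) : Prop :=
  exists (f : X -> Y) (L C : R),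
    [/\ 1 <= L, 0 <= C,
        forall x x', ((L^-1)%:E * dX x x' - C%:E <= dY (f x) (f x'))%E,
        forall x x', (dY (f x) (f x') <= L%:E * dX x x' + C%:E)%E
      & forall y, exists x, (dY (f x) y <= C%:E)%E].

Definition is_tree (T : choiceType) (e : rel T) : Prop :=
  [/\ inhabited T, symmetric e, irreflexive e,
      forall x y, exists2 p, path e x p & last x p = y
    & forall c, ucycle e c -> (size c <= 2)%N].

Definition quasi_tree (R : realType) (X : Type) (d : X -> X -> \bar R) : Prop :=
  exists (T : choiceType) (e : rel T),
    is_tree e /\ quasi_isometric d (@path_dist R T (graph_complex e)).

Definition gromov_product (R : realType) (X : Type) (d : X -> X -> \bar R)
    (w x y : X) : R :=
  (fine (d x w) + fine (d y w) - fine (d x y)) / 2.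

Definition gromov_hyperbolic (R : realType) (X : Type)
    (d : X -> X -> \bar R) : Prop :=
  (forall x y, d x y \is a fin_num) /\
  exists delta : R, forall w x y z,
    Num.min (gromov_product d w x y) (gromov_product d w y z) - delta
      <= gromov_product d w x z.

Section ConedOff.
Variables (G : groupType) (S : set G) (HH : set (set G)).

Definition left_cosets : set (set G) :=
  [set C | exists g H, HH H /\ C = left_coset g H].

(* The Cayley graph of G with respect to S, together with one cone vertex for
   each left coset, joined to all the elements of that coset. *)
Definition coned_off_edge : rel (G + left_cosets)%type := fun a b =>
  match a, b with
  | inl g, inl h => `[< S (g^-1 * h)%g \/ S (h^-1 * g)%g >]
  | inl g, inr C | inr C, inl g => `[< (val C) g >]
  | inr _, inr _ => false
  end.

Definition coned_off_graph := graph_complex coned_off_edge.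

End ConedOff.

Definition finite_generating (G : groupType) (S : set G) : Prop :=
  finite_set S /\ gen S = setT.

(* Quantified over all the finite generating sets: the choice is immaterial. *)
Definition weakly_hyperbolic (R : realType) (G : groupType)
    (HH : set (set G)) : Prop :=
  [/\ finite_set HH, HH `<=` @subgroup G,
      exists S : set G, finite_generating S
    & forall S : set G, finite_generating S ->
        gromov_hyperbolic (@path_dist R _ (coned_off_graph S HH))].

Section RAAG.
Variables (V : finType) (e : rel V).

Definition raag_relators : set (word V) :=
  [set r | exists v w : V, e v w /\
     r = [:: (v, true); (w, true); (v, false); (w, false)]].

Definition raag : groupType := presented raag_relators.

Definition raag_gen (v : V) : raag := word_class raag_relators [:: (v, true)].

(* Full subgraphs are given by their vertex sets. *)
Definition raag_sub (L : {set V}) : set raag :=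
  gen [set raag_gen v | v in [set` L]].

Definition is_join (L : {set V}) : Prop :=
  exists A B : {set V},
    [/\ A != finset.set0, B != finset.set0, [disjoint A & B]%B, L = (A :|: B)%SET
      & forall a b, a \in A -> b \in B -> e a b].

Definition is_max_join (L : {set V}) : Prop :=
  is_join L /\ forall L' : {set V}, is_join L' -> L \subset L' -> L' = L.

(* The cells of the universal cover of the Salvetti complex, i.e. of the Cayley
   square complex of the presentation: vertices g, edges {g, gv} and, for v, w
   adjacent, squares {g, gv, gw, gvw}. A cell is determined by its vertices, and
   is represented by the set of these. *)
Definition salvetti_cover : set (set raag) :=
  [set c | [\/ exists g, c = [set g],
               exists g v, c = [set g; (g * raag_gen v)%g]
             | exists g v w, e v w /\
                 c = [set x | [\/ x = g, x = (g * raag_gen v)%g,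
                                 x = (g * raag_gen w)%g
                               | x = (g * raag_gen v * raag_gen w)%g]]]].

(* Subcomplexes are sets of cells. *)
Definition full_subcomplex (Y : set raag) : set (set raag) :=
  [set c | salvetti_cover c /\ c `<=` Y].

Definition std_subcomplex (g : raag) (L : {set V}) : set (set raag) :=
  full_subcomplex (left_coset g (raag_sub L)).

Definition std_product_subcomplex : set (set (set raag)) :=
  [set P | exists g L, is_join L /\ P = std_subcomplex g L].

Definition max_product_subcomplex : set (set (set raag)) :=
  [set P | exists g L, is_max_join L /\ P = std_subcomplex g L].

Definition inter_simplex : set (set max_product_subcomplex) :=
  [set s | [/\ finite_set s, s !=set0 &
     exists2 Q, std_product_subcomplex Q & Q `<=` \bigcap_(P in s) val P]].

Lemma inter_simplex_finite s : inter_simplex s -> finite_set s.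
Proof. by case. Qed.

Lemma inter_simplex_nonempty s : inter_simplex s -> s !=set0.
Proof. by case. Qed.

Lemma inter_simplex_face s t :
  inter_simplex s -> t `<=` s -> t !=set0 -> inter_simplex t.
Proof.
move=> [fs _ [Q HQ Qs]] ts t0; split=> //; first exact: sub_finite_set fs.
by exists Q => // x Qx P tP; apply: Qs => //; exact: ts.
Qed.

Lemma inter_simplex_vertex P : inter_simplex [set P].
Proof.
split; [exact: finite_set1|by exists P|exists (val P)].
  by have /set_mem[g [L [[jL _] ->]]] := valP P; exists g, L.
by move=> x Px _ ->.
Qed.

Definition intersection_complex : scomplex max_product_subcomplex :=
  SComplex inter_simplex_finite inter_simplex_nonempty inter_simplex_face
           inter_simplex_vertex.

Definition join_subgroups : set (set raag) :=
  [set raag_sub L | L in [set L | is_join L]].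

End RAAG.

Arguments intersection_complex {V} e.
Arguments join_subgroups {V} e.

(* Main.v *)
(* In a connected graph with a base point, let the level of a vertex be its
   distance to the base point, and let a layer be a class of vertices of level n
   that are connected outside the ball of radius n - 1. Layers form a tree, and if
   their diameters are at most D, then this tree approximates distances up to the
   additive error D; applied to every base point, this also yields the four-point
   condition for the graph.

   Layers are bounded because of the hyperplanes of the Salvetti cover: the carrier
   of a hyperplane lies in a coset of A(star v), a join subgroup, so it has bounded
   diameter both in the coned-off Cayley graph and in the intersection complex.
   Let x, y be in one layer. A hyperplane separating x from y is crossed by a path
   from x to y outside the ball, as well as by the union of geodesics from x and
   from y to the base point; so it passes near x or near y. As a minimal word from
   x to y crosses only hyperplanes that separate x from y, x and y are close. *)
Require Import Defs.
From mathcomp Require Import all_boot all_order all_algebra.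
From mathcomp Require Import all_classical all_reals.
From mathcomp Require Import ereal zify ring lra.

Set Implicit Arguments.
Unset Strict Implicit.
Unset Printing Implicit Defensive.
Import Order.TTheory GRing.Theory Num.Theory.
Local Open Scope classical_set_scope.

(** * Walks, levels and the layering tree *)

(** The relations [E] used below are reflexive, so walks may idle and [walk E n x y] expresses that
    the distance is at most [n]. *)
Fixpoint walk (X : Type) (E : X -> X -> Prop) (n : nat) (x y : X) : Prop :=
  if n is m.+1 then exists2 z, E x z & walk E m z y else x = y.

Inductive conn (X : Type) (E : X -> X -> Prop) (Q : X -> Prop) : X -> X -> Prop :=
| conn_refl x : Q x -> conn E Q x x
| conn_step x y z : Q x -> E x y -> conn E Q y z -> conn E Q x z.

Section Walk.
Variables (X : Type) (E : X -> X -> Prop).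
Hypotheses (Erefl : forall x, E x x) (Esym : forall x y, E x y -> E y x).
Implicit Types x y z : X.

Lemma walk_cat m n x y z : walk E m x y -> walk E n y z -> walk E (m + n) x z.
Proof.
elim: m x => [|m IHm] x /=; first by move->.
by case=> t xt ty yz; exists t => //; exact: IHm.
Qed.

Lemma walk1 x y : E x y -> walk E 1 x y.
Proof. by exists y. Qed.

Lemma walk_idle n x : walk E n x x.
Proof. by elim: n => [//|n IHn] /=; exists x. Qed.

Lemma walk_le m n x y : (m <= n)%N -> walk E m x y -> walk E n x y.
Proof. by move=> /subnKC <- xy; apply: walk_cat xy (walk_idle _ _). Qed.

Lemma walk_sym n x y : walk E n x y -> walk E n y x.
Proof.
elim: n x => [//|n IHn] x [z /Esym xz /IHn yz].
by rewrite -addn1; apply: walk_cat yz (walk1 xz).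
Qed.

Variable Q : X -> Prop.

Lemma conn_end x y : conn E Q x y -> Q x /\ Q y.
Proof. by elim=> // {}x {}y z Qx _ _ []. Qed.

Lemma conn_trans x y z : conn E Q x y -> conn E Q y z -> conn E Q x z.
Proof.
by elim=> // {}x {}y t Qx xy _ IH /IH; apply: conn_step.
Qed.

Lemma conn1 x y : E x y -> Q x -> Q y -> conn E Q x y.
Proof. by move=> xy Qx Qy; apply: conn_step xy _ => //; exact: conn_refl. Qed.

Lemma conn_sym x y : conn E Q x y -> conn E Q y x.
Proof.
elim=> [{}x Qx|{}x {}y z Qx xy yz IH]; first exact: conn_refl.
by apply: conn_trans IH _; apply: conn1 => //; [exact: Esym|case: (conn_end yz)].
Qed.

End Walk.

Lemma conn_sub (X : Type) (E : X -> X -> Prop) (P Q : X -> Prop) x y :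
  (forall z, P z -> Q z) -> conn E P x y -> conn E Q x y.
Proof.
move=> PQ; elim=> [{}x /PQ Qx|{}x {}y z /PQ Qx xy _ IH]; first exact: conn_refl.
exact: conn_step xy IH.
Qed.

Lemma walk_map (X Y : Type) (E : X -> X -> Prop) (F : Y -> Y -> Prop)
    (f : X -> Y) n x y :
  (forall x y, E x y -> F (f x) (f y)) -> walk E n x y -> walk F n (f x) (f y).
Proof.
move=> EF; elim: n x => [|n IHn] x /=; first by move->.
by case=> z /EF xz /IHn zy; exists (f z).
Qed.

Section Distance.
Variables (X : Type) (E : X -> X -> Prop).
Hypotheses (Erefl : forall x, E x x) (Esym : forall x y, E x y -> E y x).
Hypothesis Econn : forall x y, exists n, walk E n x y.
Implicit Types x y z : X.

(** The length of some walk, chosen by [cid], bounds the search for the least length; by [gdistP]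
    the value does not depend on this choice. *)
Definition gdist x y : nat :=
  let: exist n _ := cid (Econn x y) in
  find (fun m => `[< walk E m x y >]) (iota 0 n.+1).

Lemma gdistP n x y : walk E n x y <-> (gdist x y <= n)%N.
Proof.
rewrite /gdist; case: cid => m xym; set p := fun k => _.
have hp : has p (iota 0 m.+1).
  by apply/hasP; exists m; rewrite ?mem_iota ?add0n ?leqnn//; apply/asboolP.
have := hp; rewrite has_find size_iota => lt_f.
split=> [xyn|le_n]; last first.
  apply: (walk_le Erefl le_n); have := nth_find 0%N hp.
  by rewrite nth_iota// add0n => /asboolP.
rewrite leqNgt; apply/negP => lt_n.
have := before_find 0%N lt_n; rewrite nth_iota ?add0n; last exact: ltn_trans lt_f.
by move=> /asboolP; apply.
Qed.

Lemma gdist_walk x y : walk E (gdist x y) x y.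
Proof. exact/gdistP. Qed.

Lemma gdist_triangle y x z : (gdist x z <= gdist x y + gdist y z)%N.
Proof. by apply/gdistP; apply: walk_cat; exact: gdist_walk. Qed.

Lemma gdist_sym x y : gdist x y = gdist y x.
Proof.
by apply/eqP; rewrite eqn_leq; apply/andP; split; apply/gdistP;
  apply: walk_sym => //; exact: gdist_walk.
Qed.

Lemma gdistxx x : gdist x x = 0%N.
Proof. by apply/eqP; rewrite -leqn0; apply/gdistP. Qed.

Lemma gdist_edge x y z : E x y -> (gdist x z <= (gdist y z).+1)%N.
Proof. by move=> xy; apply/gdistP; exists y => //; exact: gdist_walk. Qed.

Variable x0 : X.

Definition level x := gdist x x0.
Definition sameabove k x y := conn E (fun z => (k <= level z)%N) x y.

Lemma level0 : level x0 = 0%N.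
Proof. exact: gdistxx. Qed.

Lemma level_edge x y : E x y -> (level x <= (level y).+1)%N.
Proof. exact: gdist_edge. Qed.

Lemma sameabove_le j k x y : (j <= k)%N -> sameabove k x y -> sameabove j x y.
Proof. by move=> jk; apply: conn_sub => z; exact: leq_trans. Qed.

Lemma sameabove_refl k x : (k <= level x)%N -> sameabove k x x.
Proof. by move=> kx; apply: (@conn_refl _ E). Qed.

Lemma sameabove_sym k x y : sameabove k x y -> sameabove k y x.
Proof. by apply: (conn_sym Esym). Qed.

Lemma sameabove_trans k y x z :
  sameabove k x y -> sameabove k y z -> sameabove k x z.
Proof. by apply: conn_trans. Qed.

(** [y] is the point at level [k] of a geodesic from [x] to [x0]; levels drop by one at each step
    and so stay at least [k] before [y]. *)
Lemma ancestor k x : (k <= level x)%N -> exists y,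
  [/\ level y = k, sameabove k x y & walk E (level x - k) x y].
Proof.
move=> /subnKC; move: (_ - k)%N => n; elim: n x => [|n IHn] x lx.
  by exists x; split; [lia|apply: sameabove_refl; lia|].
have : walk E (n + k).+1 x x0 by apply/gdistP; rewrite -/(level x); lia.
move=> [y xy /gdistP]; rewrite -/(level y) => ly.
have eky : (k + n = level y)%N by have := level_edge xy; lia.
have [z [lz yz wz]] := IHn _ eky; exists z; split=> //; last by exists y.
by apply: conn_step xy yz; lia.
Qed.

(** The condition on [z] says that it lies on some geodesic from [x] to [x0]. In this form,
    geodesics can be joined to other paths as instances of [conn]. *)
Lemma geodesic_conn x :
  conn E (fun z => (gdist x z + level z <= level x)%N) x x0.
Proof.
suff main j z : (gdist x z + j <= level x)%N -> walk E j z x0 ->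
    conn E (fun z => (gdist x z + level z <= level x)%N) z x0.
  by apply: main (gdist_walk x x0); rewrite gdistxx.
elim: j z => [|j IHj] z le.
  by move=> /= ->; apply: conn_refl; rewrite level0 addn0.
move=> /= [z' zz' /[dup] z'x0 /gdistP]; rewrite -/(level z') => lz'.
have := level_edge zz'; have := gdist_triangle z x z'.
have /gdistP := walk1 zz' => le1 le2 le3.
apply: conn_step zz' _; first lia.
by apply: IHj z'x0; lia.
Qed.

Section Layers.
Variable D : nat.
Hypothesis layer_bound : forall x y, level x = level y ->
  sameabove (level x) x y -> walk E D x y.

(** Descend from both ends to level [k]; the two ancestors lie in one layer. *)
Lemma sameabove_walk k x y : (k <= level x)%N -> (k <= level y)%N ->
  sameabove k x y -> walk E ((level x - k) + (D + (level y - k))) x y.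
Proof.
move=> kx ky xy.
have [x' [lx' sx wx]] := ancestor kx; have [y' [ly' sy wy]] := ancestor ky.
apply: walk_cat wx _; apply: walk_cat (walk_sym Esym wy).
apply: layer_bound; rewrite lx' ?ly' //.
exact: sameabove_trans (sameabove_sym sx) (sameabove_trans xy sy).
Qed.

End Layers.

(** * The tree of layers *)

Definition layer x : set X := [set y | sameabove (level x) x y].

Lemma layer_eq x y :
  layer x = layer y <-> level x = level y /\ sameabove (level x) x y.
Proof.
split=> [xy|[lxy sxy]].
  have : layer y x by rewrite -xy; exact: sameabove_refl.
  have : layer x y by rewrite xy; exact: sameabove_refl.
  rewrite /layer /= => syx sxy; have [_ le1] := conn_end sxy.
  by have [_ le2] := conn_end syx; split=> //; apply/eqP; rewrite eqn_leq le1 le2.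
apply/seteqP; split=> z; rewrite /layer /= -lxy; apply: sameabove_trans => //.
exact: sameabove_sym.
Qed.

Definition layer_node := set_type (range layer).

Definition to_layer x : layer_node :=
  SigSub (mem_set (ex_intro2 _ _ x I erefl : range layer (layer x))).

Lemma to_layer_surj (c : layer_node) : exists x, c = to_layer x.
Proof.
have /set_mem[x _ xc] := valP c; exists x.
by apply/val_inj; rewrite /= -xc.
Qed.

Lemma to_layer_eq x y :
  to_layer x = to_layer y <-> level x = level y /\ sameabove (level x) x y.
Proof.
by rewrite -layer_eq; split=> [/(congr1 val)//|xy]; apply/val_inj.
Qed.

(** The parent is the layer one step closer to the base point. Quantifying over representatives is
    harmless by [layer_parentP]. *)
Definition layer_parent (c d : layer_node) : Prop := exists x y,
  [/\ c = to_layer x, d = to_layer y, level y = (level x).+1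
    & sameabove (level x) x y].

Definition layer_edge : rel layer_node :=
  fun c d => `[< layer_parent c d \/ layer_parent d c >].

Definition node_level (c : layer_node) : nat := level (projT1 (cid (to_layer_surj c))).

Lemma node_levelE x : node_level (to_layer x) = level x.
Proof.
by rewrite /node_level; case: cid => y /= /to_layer_eq[].
Qed.

Lemma layer_parentP x y : layer_parent (to_layer x) (to_layer y) <->
  level y = (level x).+1 /\ sameabove (level x) x y.
Proof.
split=> [[x' [y' [/to_layer_eq[lx xx] /to_layer_eq[ly yy] l s]]]|[l s]].
  split; first by rewrite lx ly.
  apply: sameabove_trans xx _; rewrite lx; apply: sameabove_trans s _.
  by apply: sameabove_sym; apply: sameabove_le yy; rewrite ly l.
by exists x, y.
Qed.

Lemma layer_parent_level c d : layer_parent c d -> node_level d = (node_level c).+1.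
Proof. by move=> [x [y [-> -> l _]]]; rewrite !node_levelE. Qed.

(** Both parents are connected to [d] without going below their level, hence to each other through
    [d]: this is why layers form a tree. *)
Lemma layer_parent_uniq c c' d : layer_parent c d -> layer_parent c' d -> c = c'.
Proof.
have [x ->] := to_layer_surj c; have [x' ->] := to_layer_surj c'.
have [y ->] := to_layer_surj d => /layer_parentP[l s] /layer_parentP[l' s'].
have lx : level x = level x' by lia.
apply/to_layer_eq; split=> //; apply: sameabove_trans s _.
by rewrite lx; exact: sameabove_sym.
Qed.

Lemma to_layer_edge x y : E x y ->
  to_layer x = to_layer y \/ layer_edge (to_layer x) (to_layer y).
Proof.
move=> xy; have l1 := level_edge xy; have l2 := level_edge (Esym xy).
have [lt|gt|eq] := ltngtP (level x) (level y).
- right; apply/asboolP; left; apply/layer_parentP; split; first lia.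
  by apply: conn1 => //; lia.
- right; apply/asboolP; right; apply/layer_parentP; split; first lia.
  by apply: conn1 => //; [exact: Esym|lia].
- left; apply/to_layer_eq; split=> //.
  by apply: conn1 => //; lia.
Qed.

Lemma layer_edge_sym : symmetric layer_edge.
Proof. by move=> c d; apply/asboolP/asboolP; rewrite or_comm. Qed.

(** On a cycle with at least three vertices, both neighbours of a vertex of maximal level would be
    its parent, and would thus coincide. *)
Lemma layer_tree : is_tree layer_edge.
Proof.
split.
- by constructor; exact: to_layer x0.
- exact: layer_edge_sym.
- by move=> c; apply/negP => /asboolP[] /layer_parent_level; lia.
- move=> c d; have [x ->] := to_layer_surj c; have [y ->] := to_layer_surj d.
  have [n] := Econn x y; elim: n x => [|n IHn] x /=.
    by move->; exists [::].
  case=> z /to_layer_edge xz /IHn[p zp lp]; case: xz => [->|xz]; first by exists p.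
  by exists (to_layer z :: p) => //=; rewrite xz.
- move=> c /andP[]; rewrite leqNgt => cyc uc; apply/negP => sc.
  have [a [ac amax]] : exists a, a \in c /\
      forall b, b \in c -> (node_level b <= node_level a)%N.
    case: c sc {cyc uc} => [//|a c _]; elim: c a => [|b c IHc] a.
      by exists a; rewrite mem_seq1 eqxx; split=> // b; rewrite mem_seq1 => /eqP->.
    have [d [dc dmax]] := IHc b.
    case: (leqP (node_level a) (node_level d)) => le.
      exists d; split; first by rewrite in_cons dc orbT.
      by move=> t; rewrite in_cons => /predU1P[->//|]; exact: dmax.
    exists a; split; first by rewrite in_cons eqxx.
    move=> t; rewrite in_cons => /predU1P[->//|/dmax]; lia.
  have [i c' cE] := rot_to ac.
  have cyc' : cycle layer_edge (a :: c') by rewrite -cE rot_cycle.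
  have uc' : uniq (a :: c') by rewrite -cE rot_uniq.
  have sc' : (2 < size (a :: c'))%N by rewrite -cE size_rot.
  have amax' b : b \in a :: c' -> (node_level b <= node_level a)%N.
    by rewrite -cE mem_rot; exact: amax.
  have par b : b \in a :: c' -> layer_edge a b -> layer_parent b a.
    by move=> /amax' le /asboolP[/layer_parent_level|//]; lia.
  case: c' => [//|b c'] in cyc' uc' sc' amax' par {cE}.
  case/lastP: c' => [//|c' d] in cyc' uc' sc' amax' par.
  have bd : b = d.
    apply: (@layer_parent_uniq b d a); apply: par.
    - by rewrite !inE eqxx orbT.
    - by move: cyc' => /= /andP[].
    - by rewrite !inE mem_rcons in_cons eqxx !orbT.
    - move: cyc'; rewrite (cycle_path a) /= last_rcons => /and3P[da _ _].
      by rewrite layer_edge_sym.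
  by move: uc' => /= /and3P[_]; rewrite bd mem_rcons in_cons eqxx.
Qed.

(** [k] is the lowest level on the walk, which has to descend from the layer of [x] to level [k] and
    climb up to that of [y]. *)
Lemma layer_walk_common n x y :
  walk (fun c d => c = d \/ layer_edge c d) n (to_layer x) (to_layer y) ->
  exists k, [/\ (k <= level x)%N, (k <= level y)%N, sameabove k x y
    & (level x + level y <= n + k.*2)%N].
Proof.
elim: n x => [|n IHn] x /=.
  move=> /to_layer_eq[l s]; exists (level x).
  by split=> //; lia.
case=> c; have [z ->] := to_layer_surj c => xz /IHn[k [kz ky szy le]].
case: xz => [/to_layer_eq[l s]|/asboolP[]/layer_parentP[l s]].
- exists k; split=> //; [lia| |lia].
  by apply: sameabove_trans szy; apply: sameabove_le s; lia.
- have [kx|kx] := leqP k (level x).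
    exists k; split=> //; last lia.
    by apply: sameabove_trans szy; apply: sameabove_le s.
  exists (level x); split=> //; [lia| |lia].
  by apply: sameabove_trans s _; apply: sameabove_le szy; lia.
- exists k; split=> //; [lia| |lia].
  by apply: sameabove_trans szy; apply: sameabove_sym; apply: sameabove_le s.
Qed.

Lemma to_layer_walk n x y : walk E n x y ->
  walk (fun c d => c = d \/ layer_edge c d) n (to_layer x) (to_layer y).
Proof. exact: walk_map to_layer_edge. Qed.

End Distance.

(** * Path metrics of simplicial complexes *)

Local Open Scope ring_scope.

(** Equality or adjacency in the 1-skeleton: the case [u = v] is included because vertices are
    simplices. *)
Definition skeleton (V : choiceType) (K : scomplex V) (u v : V) : Prop :=
  simplex K [set u; v].

Section Realization.
Variables (R : realType) (V : choiceType) (K : scomplex V).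
Implicit Types (p q : realization R K) (f : V -> R) (u v : V) (r : seq V).

Lemma skeleton_refl v : skeleton K v v.
Proof. by rewrite /skeleton setUid; exact: simplex_vertex. Qed.

Lemma skeleton_sym u v : skeleton K u v -> skeleton K v u.
Proof. by rewrite /skeleton setUC. Qed.

Lemma simplex_skeleton s u v : simplex K s -> s u -> s v -> skeleton K u v.
Proof.
move=> Ks su sv; apply: simplex_face Ks _ _; last by exists u; left.
by move=> w [->|->].
Qed.

Lemma fsum_seq r (F : V -> R) : uniq r -> (forall v, v \notin r -> F v = 0) ->
  \sum_(v \in [set: V]) F v = \sum_(v <- r) F v.
Proof.
move=> ur F0; rewrite (@bigfs _ _ _ _ r predT) //; last by move=> v _; exact: F0.
by congr (\big[_/_]_(v \in _) _); apply/seteqP; split.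
Qed.

Lemma simplex_seq (s : set V) : simplex K s -> exists r, uniq r /\ s = [set` r].
Proof.
move=> /simplex_finite/finite_seqP[r ->]; exists (undup r).
split; first exact: undup_uniq.
by apply/seteqP; split=> v /=; rewrite mem_undup.
Qed.

Definition carried r p := forall v, v \notin r -> p v = 0.

Lemma common_simplex_seq p q : common_simplex p q ->
  exists r, [/\ uniq r, carried r p, carried r q & simplex K [set` r]].
Proof.
move=> [s Ks [ps qs]]; have [r [ur sE]] := simplex_seq Ks.
rewrite {}sE in Ks ps qs.
by exists r; split=> // v vr; apply/eqP; apply: contraNT vr => v0;
  [exact: ps|exact: qs].
Qed.

Lemma bary_seq r p : uniq r -> carried r p -> \sum_(v <- r) p v = 1.
Proof. by move=> ur pr; rewrite -(bary_sum p) (fsum_seq ur). Qed.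

Lemma common_simplex_refl p : common_simplex p p.
Proof. by exists [set v | p v != 0]; [exact: bary_supp|split]. Qed.

Lemma bary_le1 p v : p v <= 1.
Proof.
have [r [ur pr _ _]] := common_simplex_seq (common_simplex_refl p).
have [vr|/pr ->] := boolP (v \in r); last exact: ler01.
rewrite -(bary_seq ur pr) (big_rem v) //= lerDl.
by apply: sumr_ge0 => u _; exact: bary_ge0.
Qed.

Lemma simplex_dist_seq r p q : uniq r -> carried r p -> carried r q ->
  simplex_dist p q = Num.sqrt ((\sum_(v <- r) (p v - q v) ^+ 2) / 2).
Proof.
move=> ur pr qr; rewrite /simplex_dist (fsum_seq ur) // => v vr.
by rewrite pr // qr // subrr expr0n.
Qed.

Lemma simplex_dist_le1 p q : common_simplex p q -> simplex_dist p q <= 1.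
Proof.
move=> /common_simplex_seq[r [ur pr qr _]]; rewrite (simplex_dist_seq ur pr qr).
rewrite -[leRHS]sqrtr1; apply: ler_wsqrtr; rewrite ler_pdivrMr // mul1r.
(* For coordinates in [0, 1] the square of the difference is at most the sum, and the coordinates of
   both points add up to 2. *)
have -> : (2 : R) = \sum_(v <- r) (p v + q v).
  by rewrite big_split /= (bary_seq ur pr) (bary_seq ur qr).
apply: ler_sum => v _; have := bary_ge0 p v; have := bary_ge0 q v.
by have := bary_le1 p v; have := bary_le1 q v; nra.
Qed.

Lemma walk_chain n p q : walk (@common_simplex R V K) n p q ->
  exists c : nat -> realization R K, [/\ c 0%N = p, c n = q
    & forall i, (i < n)%N -> common_simplex (c i) (c i.+1)].
Proof.
elim: n p => [|n IHn] p /=; first by move=> ->; exists (fun=> q).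
case=> t pt /IHn[c [c0 cn cc]].
exists (fun i => if i is j.+1 then c j else p); split=> // -[_|i].
  by rewrite c0.
by rewrite ltnS; exact: cc.
Qed.

Lemma walk_path_dist n p q : walk (@common_simplex R V K) n p q ->
  (path_dist p q <= n%:R%:E)%E.
Proof.
move=> /walk_chain[c [c0 cn cc]].
apply: (@le_trans _ _ (\sum_(i < n) simplex_dist (c i) (c i.+1))%:E).
  by apply: ereal_inf_lbound; exists n, c.
rewrite lee_fin; apply: (@le_trans _ _ (\sum_(i < n) (1 : R))).
  by apply: ler_sum => i _; apply: simplex_dist_le1; exact: cc.
by rewrite sumr_const card_ord.
Qed.

Section VertexPoint.
Variable v : V.

Lemma vertex_supp : [set u | (u == v)%:R != 0 :> R] = [set v].
Proof.
by apply/seteqP; split=> u /=; rewrite pnatr_eq0 eqb0 negbK => /eqP.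
Qed.

Lemma vertex_point_supp : simplex K [set u | (u == v)%:R != 0 :> R].
Proof. by rewrite vertex_supp; exact: simplex_vertex. Qed.

Lemma vertex_point_sum : \sum_(u \in [set: V]) ((u == v)%:R : R) = 1.
Proof.
rewrite (@fsum_seq [:: v]) //; first by rewrite big_seq1 eqxx.
by move=> u; rewrite mem_seq1 => /negPf ->.
Qed.

Definition vertex_point : realization R K :=
  Point (fun u => ler0n R (u == v)) vertex_point_supp vertex_point_sum.

End VertexPoint.

(** Points are rounded to a vertex of their supporting simplex; this inverts [vertex_point] up to
    path distance 1. *)
Definition vertex_of p : V := projT1 (cid (simplex_nonempty (bary_supp p))).

Lemma vertex_of_supp p : p (vertex_of p) != 0.
Proof. by rewrite /vertex_of; case: cid. Qed.

Lemma vertex_of_point v : vertex_of (vertex_point v) = v.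
Proof.
have := vertex_of_supp (vertex_point v).
by rewrite /= pnatr_eq0 eqb0 negbK => /eqP.
Qed.

Lemma common_simplex_vertex p : common_simplex p (vertex_point (vertex_of p)).
Proof.
exists [set v | p v != 0]; first exact: bary_supp.
split=> // u; rewrite /= pnatr_eq0 eqb0 negbK => /eqP ->; exact: vertex_of_supp.
Qed.

Lemma common_simplex_sym p q : common_simplex p q -> common_simplex q p.
Proof. by move=> [s Ks []]; exists s. Qed.

(** The two extra steps lead from [p] to its vertex and from the vertex of [q] to [q]. *)
Lemma path_dist_upper n p q : walk (skeleton K) n (vertex_of p) (vertex_of q) ->
  (path_dist p q <= n.+2%:R%:E)%E.
Proof.
move=> pq; apply: walk_path_dist; exists (vertex_point (vertex_of p)).
  exact: common_simplex_vertex.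
rewrite -addn1; apply: (walk_cat (y := vertex_point (vertex_of q))).
  apply: walk_map pq => u v uv; exists [set u; v] => //.
  by rewrite /= !vertex_supp; split=> w ->; [left|right].
apply: walk1; apply: common_simplex_sym; exact: common_simplex_vertex.
Qed.

(** The extension of [f] to the realization that is affine on each simplex. *)
Definition mean f p : R := \sum_(v \in [set: V]) p v * f v.

Lemma mean_seq r p f : uniq r -> carried r p -> mean f p = \sum_(v <- r) p v * f v.
Proof. by move=> ur pr; apply: fsum_seq => // v /pr ->; rewrite mul0r. Qed.

Lemma mean_le f p q (a b : R) :
  (forall v, p v != 0 -> a <= f v) -> (forall v, q v != 0 -> f v <= b) ->
  a <= mean f p /\ mean f q <= b.
Proof.
have [r [ur pr _ _]] := common_simplex_seq (common_simplex_refl p).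
have [r' [ur' qr _ _]] := common_simplex_seq (common_simplex_refl q).
rewrite (mean_seq _ ur pr) (mean_seq _ ur' qr) => pa qb; split.
  rewrite -[leLHS]mul1r -(bary_seq ur pr) mulr_suml; apply: ler_sum => v _.
  have [->|/pa av] := eqVneq (p v) 0; first by rewrite !mul0r.
  by apply: ler_wpM2l => //; exact: bary_ge0.
rewrite -[leRHS]mul1r -(bary_seq ur' qr) mulr_suml; apply: ler_sum => v _.
have [->|/qb av] := eqVneq (q v) 0; first by rewrite !mul0r.
by apply: ler_wpM2l => //; exact: bary_ge0.
Qed.

Definition short f := forall u v, skeleton K u v -> f u - f v <= 1.

(** [L] is a common Lipschitz constant, on all simplices, for the affine extensions of functions
    that are 1-Lipschitz on the 1-skeleton. *)
Definition slope_bound (L : R) := forall f p q, short f ->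
  common_simplex p q -> `|mean f p - mean f q| <= L * simplex_dist p q.

Variable L : R.
Hypotheses (L1 : 1 <= L) (slopeL : slope_bound L).

Lemma mean_path_dist f p q : short f ->
  (((mean f p - mean f q) / L)%:E <= path_dist p q)%E.
Proof.
move=> sf; apply: le_ereal_inf_tmp => _ [n [c [<- <- cc ->]]].
rewrite lee_fin ler_pdivrMr; last exact: lt_le_trans ltr01 L1.
elim: n cc => [|n IHn] cc; first by rewrite big_ord0 mul0r subrr.
rewrite big_ord_recr /= mulrDl.
have := IHn (fun i lt_i => cc i (ltn_trans lt_i (ltnSn n))).
have := slopeL sf (cc n (ltnSn n)).
move=> /(le_trans (ler_norm _)); rewrite [L * _]mulrC; lra.
Qed.

Hypothesis conn : forall u v, exists n, walk (skeleton K) n u v.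

(** Extend the distance to the vertex of [q] affinely. On the simplexes of [p] and [q] it exceeds or
    falls short of its value at the chosen vertex by at most 1, which costs 2 in all. *)
Lemma path_dist_lower p q :
  ((((gdist conn (vertex_of p) (vertex_of q))%:R - 2) / L)%:E <= path_dist p q)%E.
Proof.
pose f v : R := (gdist conn v (vertex_of q))%:R.
have edge u v : skeleton K u v -> f u <= f v + 1.
  by move=> uv; rewrite /f natr1 ler_nat; apply: gdist_edge uv; exact: skeleton_refl.
have sf : short f by move=> u v /edge; lra.
apply: le_trans (mean_path_dist p q sf); rewrite lee_fin ler_pM2r; last first.
  by rewrite invr_gt0; exact: lt_le_trans ltr01 L1.
have [] := @mean_le f p q (f (vertex_of p) - 1) 1.
- move=> v pv; have : skeleton K (vertex_of p) v.
    by apply: simplex_skeleton (bary_supp p) _ pv; exact: vertex_of_supp.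
  by move/edge; lra.
- move=> v qv; have : skeleton K v (vertex_of q).
    by apply: simplex_skeleton (bary_supp q) qv _; exact: vertex_of_supp.
  move/edge; rewrite {2}/f gdistxx; first by rewrite add0r.
  exact: skeleton_refl.
by rewrite /f; lra.
Qed.

Lemma path_dist_fin p q : path_dist p q \is a fin_num.
Proof.
have := path_dist_lower p q.
have := path_dist_upper (gdist_walk skeleton_refl conn (vertex_of p) (vertex_of q)).
by case: path_dist.
Qed.

Lemma path_dist_bounds p q (d := gdist conn (vertex_of p) (vertex_of q)) :
  (d%:R - 2) / L <= fine (path_dist p q) <= d%:R + 2.
Proof.
have := path_dist_lower p q.
have := path_dist_upper (gdist_walk skeleton_refl conn (vertex_of p) (vertex_of q)).
rewrite -(fineK (path_dist_fin p q)) !lee_fin -/d => h1 h2.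
by rewrite h2 /=; move: h1; rewrite -addn2 natrD.
Qed.

End Realization.

(** * Lipschitz constants for graphs and for complexes of bounded dimension *)

Section SlopeBounds.
Variables (R : realType) (V : choiceType).

Lemma graph_slope (e : rel V) : slope_bound (R := R) (graph_complex e) 1.
Proof.
move=> f p q sf [s [u [v [uv ->]]] [ps qs]].
have car (t : realization R (graph_complex e)) :
    [set w | t w != 0] `<=` [set u; v] -> carried [:: u; v] t.
  move=> ts w; rewrite !inE => wuv; apply/eqP; apply: contraNT wuv => /ts[] /= ->.
    by rewrite eqxx.
  by rewrite eqxx orbT.
have {}ps := car _ ps; have {}qs := car _ qs; rewrite mul1r.
have [E|nuv] := eqVneq u v.
  have car1 (t : realization R (graph_complex e)) :
      carried [:: u; v] t -> carried [:: u] t.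
    by move=> tuv w wu; apply: tuv; rewrite !inE E in wu *; rewrite orbb.
  have pu := car1 _ ps; have qu := car1 _ qs.
  have := bary_seq (isT : uniq [:: u]) pu; have := bary_seq (isT : uniq [:: u]) qu.
  rewrite !(mean_seq _ (isT : uniq [:: u])) // !big_seq1 => -> ->.
  by rewrite subrr normr0 sqrtr_ge0.
have ur : uniq [:: u; v] by rewrite /= inE nuv.
have := bary_seq ur ps; have := bary_seq ur qs.
rewrite (simplex_dist_seq ur) // !(mean_seq _ ur) // !big_cons !big_nil !addr0.
move=> qE pE.
(* The weights sum to 1, so the two coordinates of [p - q] are opposite, and with edges of length 1
   the distance is the absolute value of one of them. *)
have -> : ((p u - q u) ^+ 2 + (p v - q v) ^+ 2) / 2 = (p u - q u) ^+ 2.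
  have -> : p v = 1 - p u by rewrite -pE addrC addKr.
  have -> : q v = 1 - q u by rewrite -qE addrC addKr.
  by field.
have -> : p u * f u + p v * f v - (q u * f u + q v * f v) = (p u - q u) * (f u - f v).
  have -> : p v = 1 - p u by rewrite -pE addrC addKr.
  have -> : q v = 1 - q u by rewrite -qE addrC addKr.
  by ring.
rewrite sqrtr_sqr normrM ler_piMr // ler_norml.
have suv : skeleton (graph_complex e) u v by exists u, v.
by have := sf _ _ suv; have := sf _ _ (skeleton_sym suv); lra.
Qed.

(** Each of the at most [N] vertices of a simplex contributes at most twice the distance to the
    variation of the affine extension. *)
Lemma bounded_slope (K : scomplex V) (N : nat) :
  (forall s, simplex K s -> exists2 r : seq V, (size r <= N)%N & s `<=` [set` r]) ->
  slope_bound (R := R) K (2 * N%:R).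
Proof.
move=> bd f p q sf /common_simplex_seq[r [ur pr qr Kr]].
have sN : (size r <= N)%N.
  have [r' r'N rr'] := bd _ Kr; apply: leq_trans r'N.
  by apply: uniq_leq_size => // v; exact: rr'.
set d := simplex_dist p q; have d0 : 0 <= d by exact: sqrtr_ge0.
have dv v : v \in r -> `|p v - q v| <= 2 * d.
  move=> vr; rewrite /d (simplex_dist_seq ur) // -ler_pdivrMl //.
  have -> : 2^-1 * `|p v - q v| = `|(p v - q v) / 2|.
    by rewrite normrM mulrC (@ger0_norm _ 2^-1) // invr_ge0.
  rewrite -sqrtr_sqr; apply: ler_wsqrtr; rewrite (big_rem v) //=.
  have : 0 <= \sum_(i <- rem v r) (p i - q i) ^+ 2.
    by apply: sumr_ge0 => i _; exact: sqr_ge0.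
  have -> : ((p v - q v) / 2) ^+ 2 = (p v - q v) ^+ 2 / 4 by field.
  by have := sqr_ge0 (p v - q v); lra.
have [v0 v0r] : exists v0, v0 \in r by have [v0] := simplex_nonempty Kr; exists v0.
(* The coordinates of [p] and [q] have equal sums, so [f] may be shifted by its value at a vertex of
   the simplex, which leaves values of modulus at most 1. *)
have -> : mean f p - mean f q = \sum_(v <- r) (p v - q v) * (f v - f v0).
  have -> : mean f p - mean f q =
      mean f p - mean f q - (\sum_(v <- r) p v - \sum_(v <- r) q v) * f v0.
    by rewrite (bary_seq ur pr) (bary_seq ur qr) subrr mul0r subr0.
  rewrite !(mean_seq _ ur) // -!sumrB mulr_suml -sumrB.
  by apply: eq_bigr => v _; ring.
apply: (@le_trans _ _ (\sum_(v <- r) 2 * d)).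
  apply: (le_trans (ler_norm_sum _ _ _)); rewrite big_seq [leRHS]big_seq.
  apply: ler_sum => v vr; rewrite normrM.
  have : `|f v - f v0| <= 1.
    have vv0 : skeleton K v v0 by apply: simplex_skeleton Kr _ _.
    by rewrite ler_norml; have := sf _ _ vv0; have := sf _ _ (skeleton_sym vv0); lra.
  have := dv v vr; have := normr_ge0 (p v - q v); nra.
rewrite big_const_seq count_predT iter_addr_0 -[2 * d *+ _]mulr_natl.
have : (size r)%:R <= N%:R :> R by rewrite ler_nat.
by nra.
Qed.

End SlopeBounds.

Lemma graph_skeletonP (V : choiceType) (e : rel V) (u v : V) : symmetric e ->
  skeleton (graph_complex e) u v <-> u = v \/ e u v.
Proof.
move=> e_sym; split=> [[a [b [ab uvE]]]|uv]; last by exists u, v.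
have /= : [set a; b] u by rewrite -uvE; left.
have /= : [set a; b] v by rewrite -uvE; right.
case=> -> [] ->; [by left| |exact: ab|by left].
by case: ab => [->|ab]; [left|right; rewrite e_sym].
Qed.

(** * Quasi-trees and hyperbolicity from bounded layers *)

Section Layered.
Variables (R : realType) (V : choiceType) (K : scomplex V).
Hypothesis conn : forall u v, exists n, walk (skeleton K) n u v.
Variable D : nat.
Let Krefl := @skeleton_refl V K.
Let Ksym := @skeleton_sym V K.

Definition layers_bounded (x0 : V) := forall x y,
  level conn x0 x = level conn x0 y ->
  sameabove conn x0 (level conn x0 x) x y -> walk (skeleton K) D x y.

(** A point is sent to the layer of a vertex of its simplex. Graph distances drop by at most [D]
    under this map, and [path_dist_bounds] compares both path metrics with graph distances. *)
Lemma quasi_tree_of_layers (L : R) (x0 : V) : 1 <= L -> slope_bound K L ->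
  layers_bounded x0 -> quasi_tree (@path_dist R V K).
Proof.
move=> L1 slope bd.
pose T : choiceType := set_type (range (layer conn x0)).
pose eT : rel T := @layer_edge _ _ conn x0.
have tree : is_tree eT := layer_tree Krefl Ksym conn x0.
pose phi : V -> T := @to_layer _ _ conn x0.
have skelT c d : skeleton (graph_complex eT) c d <-> c = d \/ eT c d.
  exact/graph_skeletonP/layer_edge_sym.
have walkT n x y : walk (skeleton K) n x y ->
    walk (skeleton (graph_complex eT)) n (phi x) (phi y).
  by apply: walk_map => u v uv; apply/skelT; exact: to_layer_edge uv.
have Tskel n c d : walk (skeleton (graph_complex eT)) n c d ->
    walk (fun c d : T => c = d \/ eT c d) n c d.
  by apply: (@walk_map _ _ _ _ id) => u v /skelT.
have connT c d : exists n, walk (skeleton (graph_complex eT)) n c d.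
  have [x ->] := to_layer_surj c; have [y ->] := to_layer_surj d.
  by have [n xy] := conn x y; exists n; exact: walkT.
exists T, eT; split=> //.
have bK := path_dist_bounds L1 slope conn.
have finK := path_dist_fin L1 slope conn.
have bT := path_dist_bounds (lexx 1) (@graph_slope R T eT) connT.
have finT := path_dist_fin (lexx 1) (@graph_slope R T eT) connT.
pose f (p : realization R K) : realization R (graph_complex eT) :=
  vertex_point R _ (phi (vertex_of p)).
have L0 : 0 < L by exact: lt_le_trans L1.
have key p q (d := gdist conn (vertex_of p) (vertex_of q))
    (d' := gdist connT (vertex_of (f p)) (vertex_of (f q))) :
    d'%:R <= d%:R :> R /\ d%:R <= d'%:R + D%:R :> R.
  rewrite -natrD !ler_nat /d' !vertex_of_point; split.
    by apply/(gdistP (@skeleton_refl _ _))/walkT/gdist_walk.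
  have := gdist_walk (@skeleton_refl _ (graph_complex eT)) connT
    (phi (vertex_of p)) (phi (vertex_of q)).
  move=> /Tskel/(layer_walk_common Ksym)[k [kp kq pq le]].
  have /(gdistP Krefl conn) := sameabove_walk Krefl Ksym bd kp kq pq.
  by rewrite -/d; lia.
(* The rounding of points to vertices costs 2 in each of the two metrics. *)
exists f, L, (D%:R + 4); split=> //.
- move=> p q; rewrite -(fineK (finK p q)) -(fineK (finT _ _)).
  rewrite -EFinM -EFinB lee_fin.
  have [h1 h2] := key p q; have /andP[h3 h4] := bT (f p) (f q).
  have /andP[h5 h6] := bK p q; rewrite divr1 in h3.
  have : L^-1 * fine (path_dist p q) <= (gdist conn (vertex_of p) (vertex_of q))%:R + 2.
    apply: (@le_trans _ _ (L^-1 * ((gdist conn (vertex_of p) (vertex_of q))%:R + 2))).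
      by rewrite ler_pM2l // invr_gt0.
    by rewrite ler_piMl ?addr_ge0 // invf_le1.
  by lra.
- move=> p q; rewrite -(fineK (finK p q)) -(fineK (finT _ _)).
  rewrite -EFinM -EFinD lee_fin.
  have [h1 h2] := key p q; have /andP[h3 h4] := bT (f p) (f q).
  have /andP[h5 h6] := bK p q.
  rewrite ler_pdivrMr // mulrC in h5.
  have : (0 : R) <= D%:R by [].
  by lra.
- move=> y; have [x xE] := to_layer_surj (vertex_of y).
  exists (vertex_point R _ x); apply: (@le_trans _ _ (2%:R%:E)).
    by apply: path_dist_upper; rewrite /f !vertex_of_point.
  by rewrite lee_fin; have : (0 : R) <= D%:R by []; lra.
Qed.

End Layered.

(** For the graph distance and up to an error controlled by [D], the Gromov product of two vertices
    at [w] is the highest [k] such that they are connected at levels at least [k]; these heights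
    satisfy the ultrametric inequality by transitivity of [sameabove]. *)
Lemma hyperbolic_of_layers (R : realType) (V : choiceType) (e : rel V)
    (conn : forall u v, exists n, walk (skeleton (graph_complex e)) n u v) (D : nat) :
  (forall x0, layers_bounded conn D x0) ->
  gromov_hyperbolic (@path_dist R V (graph_complex e)).
Proof.
move=> bd.
have Krefl := @skeleton_refl V (graph_complex e).
have Ksym := @skeleton_sym V (graph_complex e).
have bK p q := path_dist_bounds (lexx 1) (@graph_slope R V e) conn p q.
split; first exact: path_dist_fin (lexx 1) (@graph_slope R V e) conn.
(* Two Gromov products involve six path distances, each within 2 of a graph distance; halved, this
   gives 6. *)
exists (D%:R + 6) => w x y z; set w0 := vertex_of w.
have [k1 [kx ky xy le1]] := layer_walk_common Ksym (to_layer_walk Krefl Ksym conn w0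
  (gdist_walk Krefl conn (vertex_of x) (vertex_of y))).
have [k2 [ky' kz yz le2]] := layer_walk_common Ksym (to_layer_walk Krefl Ksym conn w0
  (gdist_walk Krefl conn (vertex_of y) (vertex_of z))).
pose k := minn k1 k2.
have kx' : (k <= level conn w0 (vertex_of x))%N by rewrite /k; lia.
have kz' : (k <= level conn w0 (vertex_of z))%N by rewrite /k; lia.
have xz : sameabove conn w0 k (vertex_of x) (vertex_of z).
  apply: (@sameabove_trans _ _ _ _ _ (vertex_of y)).
    by apply: sameabove_le xy; rewrite geq_minl.
  by apply: sameabove_le yz; rewrite geq_minr.
have := sameabove_walk Krefl Ksym (bd w0) kx' kz' xz.
move=> /(gdistP Krefl conn) dxz.
have dk : (gdist conn (vertex_of x) (vertex_of z) +
      (level conn w0 (vertex_of x) + level conn w0 (vertex_of y)) <=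
      level conn w0 (vertex_of x) + level conn w0 (vertex_of z) + D +
      gdist conn (vertex_of x) (vertex_of y))%N \/
    (gdist conn (vertex_of x) (vertex_of z) +
      (level conn w0 (vertex_of y) + level conn w0 (vertex_of z)) <=
      level conn w0 (vertex_of x) + level conn w0 (vertex_of z) + D +
      gdist conn (vertex_of y) (vertex_of z))%N.
  by move: le1 le2 dxz kx' kz'; rewrite /k /minn; case: ifP => _; [left|right]; lia.
rewrite /gromov_product lerBlDr ge_min; apply/orP.
have /andP[] := bK x w; have /andP[] := bK y w; have /andP[] := bK z w.
have /andP[] := bK x y; have /andP[] := bK y z; have /andP[] := bK x z.
have := ler0n R D; rewrite -/w0 => *.
by case: dk; rewrite -(ler_nat R) !natrD /level => dk; [left|right]; lra.
Qed.

Local Close Scope ring_scope.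
Local Open Scope group_scope.

(** * Words and hyperplanes in right-angled Artin groups *)

Section RaagWords.
Variables (V : finType) (e : rel V).
Hypotheses (e_sym : symmetric e) (e_irr : irreflexive e).
Implicit Types (L : {set V}) (u w : word V) (g h : raag e) (v : V).

Definition raag_word w : raag e := word_class (raag_relators e) w.

Lemma raag_word_cat u w : raag_word (u ++ w) = raag_word u * raag_word w.
Proof. by rewrite /raag_word -(pres_mulE (raag_relators e)). Qed.

Lemma raag_word_nil : raag_word [::] = 1.
Proof. by []. Qed.

Lemma raag_word_cons x w : raag_word (x :: w) = raag_word [:: x] * raag_word w.
Proof. by rewrite -raag_word_cat. Qed.

Lemma raag_word_inv w : raag_word (inv_word w) = (raag_word w)^-1.
Proof. by rewrite /raag_word -(pres_invE (raag_relators e)). Qed.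

Lemma raag_word_eqv u w :
  word_eqv (raag_relators e) u w -> raag_word u = raag_word w.
Proof. by move=> uw; apply/word_classP. Qed.

Lemma raag_word_surj g : exists w, g = raag_word w.
Proof. by exists (repr g); rewrite /raag_word word_class_repr. Qed.

Lemma raag_word_neg v : raag_word [:: (v, false)] = (raag_gen e v)^-1.
Proof. by rewrite -raag_word_inv. Qed.

Lemma raag_word_pos v : raag_word [:: (v, true)] = raag_gen e v.
Proof. by []. Qed.

Lemma raag_commute v v' : e v v' -> commute (raag_gen e v) (raag_gen e v').
Proof.
move=> vv'.
have : raag_word [:: (v, true); (v', true); (v, false); (v', false)] = 1.
  apply: raag_word_eqv.
  apply: (@word_eqv_rel _ _ [::] [:: (v, true); (v', true); (v, false); _] [::]).
  by exists v, v'.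
rewrite raag_word_cons (raag_word_cons (v', true)) (raag_word_cons (v, false)).
rewrite !raag_word_neg !raag_word_pos /commute => h.
apply: (mulIg (raag_gen e v)^-1); apply: (mulIg (raag_gen e v')^-1).
by rewrite -!mulgA h !mulgA mulgK mulgV.
Qed.

Lemma raag_sub_subgroup L : subgroup (raag_sub (e := e) L).
Proof. exact: gen_subgroup. Qed.

Lemma raag_sub1 L : raag_sub L (1 : raag e).
Proof. by case: (raag_sub_subgroup L). Qed.

Lemma raag_subM L g h : raag_sub L g -> raag_sub L h -> raag_sub L (g * h).
Proof. by case: (raag_sub_subgroup L) => _ + _; exact. Qed.

Lemma raag_subV L g : raag_sub L g -> raag_sub L g^-1.
Proof. by case: (raag_sub_subgroup L) => _ _; exact. Qed.

Lemma raag_sub_gen L v : v \in L -> raag_sub L (raag_gen e v).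
Proof. by move=> vL A [_]; apply; exists v. Qed.

Lemma raag_sub_letter L (x : letter V) : x.1 \in L -> raag_sub L (raag_word [:: x]).
Proof.
case: x => v [] /= vL; first exact: raag_sub_gen.
by rewrite raag_word_neg; apply: raag_subV; exact: raag_sub_gen.
Qed.

Definition over L w := all (fun x : letter V => x.1 \in L) w.

Lemma raag_sub_word L w : over L w -> raag_sub L (raag_word w).
Proof.
elim: w => [_|x w IHw /= /andP[xL /IHw wL]]; first exact: raag_sub1.
by rewrite raag_word_cons; apply: raag_subM => //; exact: raag_sub_letter.
Qed.

Lemma raag_subP L g : raag_sub L g -> exists2 w, over L w & g = raag_word w.
Proof.
move=> /(_ [set g | exists2 w, over L w & g = raag_word w]); apply; split.
  split=> [|_ _ [u uL ->] [w wL ->]|_ [w wL ->]]; first by exists [::].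
    by exists (u ++ w); rewrite ?raag_word_cat ?/over ?all_cat ?[all _ _]uL.
  exists (inv_word w); rewrite ?raag_word_inv // /over /inv_word all_rev all_map.
  by apply: sub_all wL => x.
by move=> _ [v /= vL <-]; exists [:: (v, true)]; rewrite //= vL.
Qed.

Lemma raag_subS L L' g : L \subset L' -> raag_sub L g -> raag_sub L' g.
Proof.
move=> /fintype.subsetP LL' /raag_subP[w wL ->]; apply: raag_sub_word.
by apply: sub_all wL => x /LL'.
Qed.

Lemma raag_subT g : raag_sub [set: V]%SET g.
Proof.
have [w ->] := raag_word_surj g; apply: raag_sub_word.
by apply/allP => x _; rewrite finset.in_setT.
Qed.

(** On words, the retraction of the group onto [A(L)] that kills all other generators. *)
Definition retract L w : word V := [seq x <- w | x.1 \in L].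

Lemma retract_cat L u w : retract L (u ++ w) = retract L u ++ retract L w.
Proof. exact: filter_cat. Qed.

(** A relator retracts to itself, to a letter followed by its inverse, or to the empty word. *)
Lemma retract_eqv L u w : word_eqv (raag_relators e) u w ->
  word_eqv (raag_relators e) (retract L u) (retract L w).
Proof.
elim=> {u w} [u|u w _ IH|u w t _ IH1 _ IH2|u x w|u r w [a [b [ab ->]]]].
- exact: word_eqv_refl.
- exact: word_eqv_sym.
- exact: word_eqv_trans IH1 IH2.
- rewrite !retract_cat {2}/retract /=; case: x => a b /=.
  case aL: (a \in L); rewrite ?aL /=; last exact: word_eqv_refl.
  exact: (@word_eqv_cancel _ _ (retract L u) (a, b)).
- rewrite !retract_cat {2}/retract /=.
  case aL: (a \in L); case bL: (b \in L); rewrite ?aL ?bL /=.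
  + apply: (@word_eqv_rel _ _ _ [:: (a, true); (b, true); (a, false); (b, false)]).
    by exists a, b.
  + exact: (@word_eqv_cancel _ _ (retract L u) (a, true)).
  + exact: (@word_eqv_cancel _ _ (retract L u) (b, true)).
  + exact: word_eqv_refl.
Qed.

Lemma retract_over L w : over L w -> retract L w = w.
Proof. by move=> wL; apply/all_filterP. Qed.

(** Geodesic words for the standard generators. *)
Definition minimal w := forall u, raag_word u = raag_word w -> (size w <= size u)%N.

Lemma minimal_ex g : exists2 w, raag_word w = g & minimal w.
Proof.
have [w0 w0g] := raag_word_surj g.
have ex : exists n, `[< exists2 w, raag_word w = g & size w = n >].
  by exists (size w0); apply/asboolP; exists w0.
case: (ex_minnP ex) => n /asboolP[w wg <-] wmin; exists w => // u ug.
by apply: wmin; apply/asboolP; exists u; rewrite // ug.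
Qed.

Lemma minimal_infix u w t : minimal (u ++ w ++ t) -> minimal w.
Proof.
move=> m w' w'w; have := m (u ++ w' ++ t).
by rewrite !raag_word_cat w'w !size_cat leq_add2l leq_add2r; exact.
Qed.

(** * Hyperplanes and their crossings *)

Definition link v : {set V} := [set v' | e v v']%SET.
Definition star v : {set V} := (v |: link v)%SET.

Lemma link_commute v g : raag_sub (link v) g -> commute (raag_gen e v) g.
Proof.
move=> /(_ [set g | commute (raag_gen e v) g]); apply; split.
  split=> [|x y|x]; [exact: commute1|exact: commuteM|exact: commuteV].
move=> x [v' /= + <-]; rewrite finset.in_set => vv'; exact: raag_commute.
Qed.

Lemma raag_sub_star v g : raag_sub (link v) g ->
  raag_sub (star v) g.
Proof. by apply: raag_subS; exact: finset.subsetUr. Qed.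

(* The edge of the Cayley graph traversed by the letter [x] from the vertex [g]
   is [{k, k v}], where [v = x.1] and [k = edge_base g x]; it is dual to the
   hyperplane given by [v] and the coset of [k] modulo [A(link v)]. *)
Definition edge_base g (x : letter V) : raag e :=
  if x.2 then g else g * (raag_gen e x.1)^-1.

Definition crosses v h g (x : letter V) : bool :=
  (x.1 == v) && `[< raag_sub (link v) (h^-1 * edge_base g x) >].

(** Crossings of the hyperplane given by [v] and [h], along the path from [g] labelled [w], are
    counted modulo 2, since inserting a cancelling pair of letters may change their number. *)
Fixpoint parity v h g w : bool :=
  if w is x :: w' then crosses v h g x (+) parity v h (g * raag_word [:: x]) w'
  else false.

Lemma parity_cat v h g u w :
  parity v h g (u ++ w) = parity v h g u (+) parity v h (g * raag_word u) w.
Proof.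
elim: u g => [|x u IHu] g /=; first by rewrite raag_word_nil mulg1.
by rewrite IHu addbA (raag_word_cons x u) mulgA.
Qed.

Lemma sub_link_shift v k h g : raag_sub (link v) k ->
  raag_sub (link v) (h^-1 * (g * k)) <-> raag_sub (link v) (h^-1 * g).
Proof.
move=> hk; split=> H; last by rewrite mulgA; exact: raag_subM.
by have := raag_subM H (raag_subV hk); rewrite -!mulgA mulgV mulg1.
Qed.

Lemma parity_cancel v h g x : parity v h g [:: x; inv_letter x] = false.
Proof.
case: x => a b; rewrite /parity /crosses /edge_base /= addbF; case: eqP => //= ->.
by case: b => /=; rewrite ?raag_word_pos ?raag_word_neg ?mulgK addbb.
Qed.

(** Opposite sides of a square are dual to one hyperplane: their base points differ by a generator
    adjacent to [v], that is, by an element of [A(link v)]. *)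
Lemma parity_rel v h g a b : e a b ->
  parity v h g [:: (a, true); (b, true); (a, false); (b, false)] = false.
Proof.
move=> ab; have cab := raag_commute ab.
rewrite /parity /crosses /edge_base /= addbF.
rewrite !raag_word_neg !raag_word_pos.
have -> : g * raag_gen e a * raag_gen e b * (raag_gen e a)^-1 = g * raag_gen e b.
  by rewrite -(mulgA g) cab -!mulgA mulgV mulg1.
rewrite mulgK.
have [av|_] := eqVneq a v; have [bv|_] := eqVneq b v => //=.
- by move: ab; rewrite av bv e_irr.
- have -> : `[< raag_sub (link v) (h^-1 * (g * raag_gen e b)) >] =
    `[< raag_sub (link v) (h^-1 * g) >]; last by case: asbool.
  apply: asbool_equiv_eq; apply: sub_link_shift; apply: raag_sub_gen.
  by rewrite /link finset.in_set -av.
- have -> : `[< raag_sub (link v) (h^-1 * (g * raag_gen e a)) >] =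
    `[< raag_sub (link v) (h^-1 * g) >]; last by case: asbool.
  apply: asbool_equiv_eq; apply: sub_link_shift; apply: raag_sub_gen.
  by rewrite /link finset.in_set -bv e_sym.
Qed.

(** Homotopy invariance: the parity depends only on the endpoints of a path, so a hyperplane has two
    sides. *)
Lemma parity_eqv v h g u w : word_eqv (raag_relators e) u w ->
  parity v h g u = parity v h g w.
Proof.
move=> uw; elim: uw g => {u w} [u|u w _ IH|u w t _ IH1 _ IH2|u x w|
  u r w [a [b [ab ->]]]] g //.
- by rewrite IH1 IH2.
- rewrite !parity_cat parity_cancel addFb -mulgA.
  rewrite (_ : raag_word [:: x; _] = 1) ?mulg1 //.
  by apply: raag_word_eqv; exact: (@word_eqv_cancel _ _ [::] x [::]).
- rewrite !parity_cat (parity_rel _ _ _ ab) addFb -mulgA.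
  rewrite (_ : raag_word [:: _; _; _; _] = 1) ?mulg1 //.
  apply: raag_word_eqv.
  apply: (@word_eqv_rel _ _ [::] [:: (a, true); (b, true); (a, false); _] [::]).
  by exists a, b.
Qed.

Lemma parity_crossing v h g w : parity v h g w ->
  exists a y c, w = a ++ y :: c /\ crosses v h (g * raag_word a) y.
Proof.
elim: w g => [//|x w IHw] g /=; case cx : (crosses v h g x).
  by exists [::], x, w; rewrite raag_word_nil mulg1.
rewrite addFb => /IHw[a [y [c [-> cy]]]]; exists (x :: a), y, c; split=> //.
by rewrite raag_word_cons mulgA.
Qed.

Lemma no_crossing_parity v h g w :
  (forall a y c, w = a ++ y :: c -> ~~ crosses v h (g * raag_word a) y) ->
  parity v h g w = false.
Proof.
move=> ncr; apply/negP => /parity_crossing[a [y [c [/ncr /negP]]]].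
exact.
Qed.

(* The part of the word between the two crossings evaluates to [k v^d] with
   [k] in [A(link v)] and [d] in {-1, 0, 1}, and retracting it onto [link v]
   yields a word for [k] that is shorter by at least two letters. *)
Lemma minimal_crosses_once v h g a x b y c :
  minimal (a ++ x :: b ++ y :: c) ->
  crosses v h (g * raag_word a) x ->
  ~~ crosses v h (g * raag_word (a ++ x :: b)) y.
Proof.
set g0 := g * raag_word a => m /andP[/eqP xv /asboolP kx].
apply/negP => /andP[/eqP yv /asboolP ky].
have {}m : minimal (x :: b ++ [:: y]).
  by apply: (@minimal_infix a _ c); move: m; rewrite /= -catA.
pose k := (edge_base g0 x)^-1 * edge_base (g * raag_word (a ++ x :: b)) y.
have kL : raag_sub (link v) k.
  have -> : k = (h^-1 * edge_base g0 x)^-1 *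
      (h^-1 * edge_base (g * raag_word (a ++ x :: b)) y).
    by rewrite /k invgM invgK -mulgA mulVKg.
  by apply: raag_subM => //; exact: raag_subV.
have vL : v \in link v = false by rewrite finset.in_set e_irr.
(* [d] is empty if [x] and [y] have opposite signs, and their common letter otherwise; if [x] is
   negative, [v] has to be moved past [k]. *)
have [d [dk dL sd]] : exists d, [/\ raag_word (x :: b ++ [:: y]) = k * raag_word d,
    retract (link v) d = [::] & (size d <= 1)%N].
  have := link_commute kL; rewrite /k /edge_base.
  rewrite (raag_word_cat a) (raag_word_cons x b) (mulgA g) -/g0.
  rewrite (raag_word_cons x (b ++ _)) (raag_word_cat b).
  move: x y xv yv {kx ky m k kL} => [? []] [? []] /= -> ->;
    rewrite ?raag_word_pos ?raag_word_neg ?invgM ?invgK -!mulgA ?mulKg => kv.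
  - exists [:: (v, true)]; rewrite /retract /= vL; split=> //.
    by rewrite raag_word_pos -!mulgA.
  - by exists [::]; split=> //; rewrite raag_word_nil mulg1.
  - exists [::]; split=> //; rewrite raag_word_nil mulg1.
    move: kv; rewrite !mulVKg /commute => kv.
    by rewrite -kv mulKg.
  - exists [:: (v, false)]; rewrite /retract /= vL; split=> //.
    move: kv; rewrite raag_word_neg !mulVKg => kv.
    by apply/esym/commuteV/commute_sym.
have [w wL kw] := raag_subP kL.
have kb : raag_word (retract (link v) b) = k.
  rewrite kw; apply/word_classP.
  have /(retract_eqv (link v)) : word_eqv (raag_relators e) (x :: b ++ [:: y]) (w ++ d).
    by apply/word_classP; rewrite -/(raag_word _) dk kw -raag_word_cat.
  rewrite retract_cat dL cats0 (retract_over wL) -cat1s !retract_cat.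
  by rewrite {1 3}/retract /= xv yv vL cats0.
have := m (retract (link v) b ++ d).
rewrite raag_word_cat kb -dk => /(_ erefl).
have : (size (retract (link v) b) <= size b)%N by rewrite size_filter count_size.
rewrite /= !size_cat /=; move: (size (retract _ _)) sd => n; lia.
Qed.

(** Another letter crossing the hyperplane dual to the edge of [x] would contradict
    [minimal_crosses_once], so there is exactly one crossing. *)
Lemma minimal_parity a x c : minimal (a ++ x :: c) ->
  parity x.1 (edge_base (raag_word a) x) 1 (a ++ x :: c).
Proof.
move=> m; set v := x.1; set h := edge_base _ _.
have cx : crosses v h (1 * raag_word a) x.
  by rewrite mul1g /crosses eqxx mulVg; apply/asboolP; exact: raag_sub1.
rewrite parity_cat no_crossing_parity => [|a1 y c1 aE].
  rewrite /= cx no_crossing_parity // => a1 y c1 cE.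
  have := @minimal_crosses_once v h 1 a x a1 y c1.
  rewrite -cE => /(_ m cx).
  by rewrite raag_word_cat (raag_word_cons x) !mulgA.
apply/negP => cy; have := @minimal_crosses_once v h 1 a1 y c1 x c.
have -> : a1 ++ y :: c1 ++ x :: c = a ++ x :: c by rewrite aE -catA.
by rewrite -aE => /(_ m cy); rewrite cx.
Qed.

(** As the bases of the edges dual to a hyperplane lie in one coset of [A(link v)], this puts its
    carrier into one coset of [A(star v)]. *)
Lemma edge_base_star g x : raag_sub (star x.1) (g^-1 * edge_base g x).
Proof.
rewrite /edge_base; case: x.2; first by rewrite mulVg; exact: raag_sub1.
by rewrite mulKg; apply: raag_subV; apply: raag_sub_gen; rewrite !inE eqxx.
Qed.

(* Every path with the same endpoints as a minimal word crosses each hyperplane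
   crossed by this word. *)
Lemma minimal_separates a x c w : minimal (a ++ x :: c) ->
  raag_word w = raag_word (a ++ x :: c) ->
  exists a' c' : word V, w = a' ++ c' /\
    raag_sub (star x.1) ((raag_word a)^-1 * raag_word a').
Proof.
move=> /minimal_parity p /word_classP /parity_eqv wE.
move: p; rewrite -wE => /parity_crossing[a' [y [c' [-> /andP[/eqP yx /asboolP k]]]]].
exists a', (y :: c'); split=> //; move: k; rewrite mul1g => k.
have := raag_subM (@edge_base_star (raag_word a) x) (raag_sub_star k).
rewrite -mulgA mulVKg.
have := raag_subV (@edge_base_star (raag_word a') y); rewrite yx => h1 h2.
by have := raag_subM h2 h1; rewrite invgM invgK -!mulgA mulVKg.
Qed.

End RaagWords.

(** * Bounded layers in graphs modelled on a right-angled Artin group *)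

Lemma eq_cat_prefix (T : Type) (u t u' t' : seq T) : u ++ t = u' ++ t' ->
  (exists s, u' = u ++ s) \/ (exists s, u = u' ++ s /\ t' = s ++ t).
Proof.
elim: u u' => [|x u IHu] [|x' u'] /=.
- by left; exists [::].
- by left; exists (x' :: u').
- by move=> <-; right; exists (x :: u).
- case=> -> /IHu[[s ->]|[s [-> ->]]]; first by left; exists s.
  by right; exists s.
Qed.

Section CoarseModel.
Variables (V : finType) (e : rel V).
Hypotheses (e_sym : symmetric e) (e_irr : irreflexive e).
Variables (X : Type) (E : X -> X -> Prop).
Hypotheses (Erefl : forall x, E x x) (Esym : forall x y, E x y -> E y x).
(** [p] maps the group to the graph [X], and [s] is a coarse section of [p]. Carriers of hyperplanes
    have bounded images by [p_star]; [s_edge] lifts an edge of [X] to a path in the group whose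
    image stays near that edge. *)
Variables (p : raag e -> X) (s : X -> raag e) (c : nat).
Hypothesis p_star : forall v g h, raag_sub (star e v) (g^-1 * h) ->
  walk E c (p g) (p h).
Hypothesis p_s : forall x, walk E c x (p (s x)).
Hypothesis s_edge : forall x y, E x y -> exists w, s y = s x * raag_word e w /\
  forall u t, w = u ++ t -> walk E c x (p (s x * raag_word e u)).

Lemma coarse_letter g (z : letter V) : walk E c (p g) (p (g * raag_word e [:: z])).
Proof.
apply: (p_star (v := z.1)); rewrite mulKg; apply: raag_sub_letter.
by rewrite !inE eqxx.
Qed.

Lemma coarse_connected x y : exists n, walk E n x y.
Proof.
have p_word g w : exists n, walk E n (p g) (p (g * raag_word e w)).
  elim: w g => [|z w IHw] g; first by exists 0%N; rewrite raag_word_nil mulg1.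
  have [n hn] := IHw (g * raag_word e [:: z]); exists (c + n)%N.
  by rewrite raag_word_cons mulgA; apply: walk_cat hn; exact: coarse_letter.
have [w wE] := raag_word_surj ((s x)^-1 * s y).
have [n] := p_word (s x) w; rewrite -wE mulVKg => hn.
exists (c + (n + c))%N; apply: walk_cat (p_s x) _; apply: walk_cat hn _.
exact/(walk_sym Esym)/p_s.
Qed.

(** Concatenate the lifts of the edges; each prefix ends within the lift of one edge, hence near a
    vertex of the path. *)
Lemma path_lift Q x y : conn E Q x y -> exists w, s y = s x * raag_word e w /\
  forall u t, w = u ++ t -> exists2 z, Q z & walk E c z (p (s x * raag_word e u)).
Proof.
elim=> [{}x Qx|{}x {}y z Qx xy _ [w2 [w2E w2P]]].
  exists [::]; rewrite raag_word_nil mulg1; split=> // -[|//] t _.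
  by exists x => //; rewrite raag_word_nil mulg1.
have [w1 [w1E w1P]] := s_edge xy; exists (w1 ++ w2); split.
  by rewrite w2E w1E raag_word_cat mulgA.
move=> u t /esym/eq_cat_prefix[[r /w1P]|[r [-> /w2P]]]; first by exists x.
by rewrite raag_word_cat mulgA -w1E.
Qed.

Local Notation dist := (gdist coarse_connected).
Local Notation lev := (level coarse_connected).
Local Notation gdistP := (gdistP Erefl coarse_connected).
Local Notation triangle := (gdist_triangle Erefl coarse_connected).
Local Notation distC := (gdist_sym Erefl Esym coarse_connected).

(* An element on a minimal word from [s x] to [s y] lies on a hyperplane which
   separates these, hence is close to the given path avoiding the ball around
   [x0] as well as to one of the geodesics from [x] and from [y] to [x0]. *)
Lemma coarse_layer_bound x0 x y : lev x0 x = lev x0 y ->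
  sameabove coarse_connected x0 (lev x0 x) x y -> walk E (13 * c) x y.
Proof.
move=> lxy /path_lift[w [wE wP]].
pose near t z := (dist t z + lev x0 z <= lev x0 t)%N.
(* The geodesics from [x] and from [y] to [x0], joined at [x0]. *)
have : conn E (fun z => near x z \/ near y z) x y.
  apply: (conn_trans (y := x0)).
    by apply: conn_sub (geodesic_conn Erefl coarse_connected x0 x) => z; left.
  apply: (conn_sym Esym).
  by apply: conn_sub (geodesic_conn Erefl coarse_connected x0 y) => z; right.
move=> /path_lift[w' [w'E w'P]].
have [m mE mmin] := minimal_ex ((s x)^-1 * s y).
have mw : raag_word e w = raag_word e m by rewrite mE wE mulKg.
have mw' : raag_word e w' = raag_word e m by rewrite mE w'E mulKg.
(* Let [q] be the image of the prefix. Carriers bring [q] within [2 * c] of a vertex [z1] at level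
   at least that of [x], and of a vertex [z2] on one of the geodesics. As [z1] and [z2] are at most
   [4 * c] apart, [z2] is within [4 * c] of the start of its geodesic, and [q] within [6 * c]. *)
have close a l t : m = a ++ l :: t ->
    (dist x (p (s x * raag_word e a)) <= 6 * c)%N \/
    (dist y (p (s x * raag_word e a)) <= 6 * c)%N.
  move=> aE; move: mmin mw mw'; rewrite aE => mmin mw mw'.
  have carrier g g' : raag_sub (star e l.1) (g^-1 * g') ->
      walk E c (p (s x * g)) (p (s x * g')).
    by move=> gg'; apply: (p_star (v := l.1)); rewrite invgM -mulgA mulKg.
  have [a1 [t1 [/wP[z1 lz1 /gdistP d1] /carrier/gdistP star1]]] :=
    minimal_separates e_sym e_irr mmin mw.
  have [a2 [t2 [/w'P[z2 lz2 /gdistP d2] /carrier/gdistP star2]]] :=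
    minimal_separates e_sym e_irr mmin mw'.
  move: (p _) (p (s x * raag_word e a1)) (p (s x * raag_word e a))
    star1 d1 star2 d2 => q2 q1 q star1 d1 star2 d2.
  have := triangle q1 z1 x0; have := triangle q q1 x0; have := triangle q2 q x0.
  have := triangle z2 q2 x0; have := triangle z2 x q2; have := triangle q2 x q.
  have := triangle z2 y q2; have := triangle q2 y q.
  have := distC q1 q; have := distC q2 q; have := distC q2 z2.
  by case: lz2; rewrite /near /level /= in lz1 lxy * => lz2; lia.
(* Proceed letter by letter as long as the prefixes are close to [x]; at the first one that is close
   to [y] instead, the distance from [x] to [y] is at most [6 * c + c + 6 * c]. *)
have close_prefix a t : m = a ++ t ->
    (dist x y <= 13 * c)%N \/ (dist x (p (s x * raag_word e a)) <= 6 * c)%N.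
  elim/last_ind: a t => [|a l IHa] t.
    have := p_s x; rewrite raag_word_nil mulg1 => /gdistP; lia.
  rewrite cat_rcons => aE; have [|dx] := IHa _ aE; first by left.
  have := coarse_letter (s x * raag_word e a) l.
  rewrite -mulgA -raag_word_cat cats1 => /gdistP dq.
  case: t aE => [|l' t]; rewrite -cat_rcons => aE.
    have sxy : s x * raag_word e (rcons a l) = s y.
      by rewrite -(cats0 (rcons a l)) -aE mE mulVKg.
    left; rewrite sxy in dq; have /gdistP := p_s y; rewrite distC.
    have := triangle (p (s y)) x y.
    by have := triangle (p (s x * raag_word e a)) x (p (s y)); lia.
  have [dx'|dy'] := close _ _ _ aE; first by right.
  left; move: (p _) (p (s x * raag_word e a)) dx dy' dq => q' q dx dy' dq.
  by have := triangle q x y; have := triangle q' q y; rewrite (distC q' y); lia.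
apply/gdistP; have [//|] := close_prefix m [::] (esym (cats0 m)).
rewrite mE mulVKg; have /gdistP := p_s y; rewrite distC => d1 d2.
by have := triangle (p (s y)) x y; lia.
Qed.

End CoarseModel.

(** * Coned-off Cayley graph and intersection complex *)

Section Cosets.
Variables (V : finType) (e : rel V).
Implicit Types (L : {set V}) (g h : raag e).

Lemma left_cosetP g L h : left_coset g (raag_sub L) h <-> raag_sub L (g^-1 * h).
Proof.
split=> [[k kL <-]|ghL]; first by rewrite mulKg.
by exists (g^-1 * h) => //; rewrite mulVKg.
Qed.

Lemma left_coset_eq g h L : raag_sub L (g^-1 * h) ->
  left_coset g (raag_sub L) = left_coset h (raag_sub L).
Proof.
move=> gh; apply/seteqP; split=> k /left_cosetP gk; apply/left_cosetP.
  by have := raag_subM (raag_subV gh) gk; rewrite invgM invgK -mulgA mulVKg.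
by have := raag_subM gh gk; rewrite -mulgA mulVKg.
Qed.

(** A word over [L] never leaves the coset; such words serve to lift edges as [s_edge] requires. *)
Lemma left_coset_path k L g h :
  left_coset k (raag_sub L) g -> left_coset k (raag_sub L) h ->
  exists w, h = g * raag_word e w /\
    forall u t, w = u ++ t -> left_coset k (raag_sub L) (g * raag_word e u).
Proof.
move=> /left_cosetP kg /left_cosetP kh; have : raag_sub L (g^-1 * h).
  by have := raag_subM (raag_subV kg) kh; rewrite invgM invgK -mulgA mulVKg.
move=> /raag_subP[w wL ghw]; exists w; rewrite -ghw mulVKg; split=> // u t wE.
apply/left_cosetP; rewrite mulgA; apply: raag_subM => //.
by apply: raag_sub_word; move: wL; rewrite wE /over all_cat => /andP[].
Qed.

Lemma std_subcomplex_vertex g L h :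
  std_subcomplex g L [set h] <-> raag_sub L (g^-1 * h).
Proof.
rewrite -left_cosetP; split=> [[_]|gh]; first exact.
by split=> [|_ -> //]; constructor 1; exists h.
Qed.

Lemma std_subcomplex_eq g h L : raag_sub L (g^-1 * h) ->
  std_subcomplex g L = std_subcomplex h L.
Proof. by move=> gh; rewrite /std_subcomplex (left_coset_eq gh). Qed.

Lemma std_subcomplexS g L L' : L \subset L' ->
  std_subcomplex g L `<=` std_subcomplex g L'.
Proof.
move=> LL' c [cX cL]; split=> // k /cL/left_cosetP kL; apply/left_cosetP.
exact: raag_subS kL.
Qed.

End Cosets.

(** * Stars, edges and maximal joins *)

Section Joins.
Variables (V : finType) (e : rel V).
Hypotheses (e_sym : symmetric e) (e_irr : irreflexive e).
Hypothesis e_connected : forall x y : V, connect e x y.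
Hypothesis e_edge : exists x y : V, e x y.
Implicit Types (L : {set V}) (g h : raag e) (v : V).

Lemma has_neighbor v : exists v', e v v'.
Proof.
have [x [y xy]] := e_edge; have /connectP[[|z p] /=] := e_connected v x.
  by move=> _ <-; exists y.
by case/andP=> vz _ _; exists z.
Qed.

(** The link is non-empty as the graph is connected and has an edge. Hence carriers of hyperplanes
    lie in cosets of join subgroups. *)
Lemma star_join v : is_join e (star e v).
Proof.
have [v' vv'] := has_neighbor v; exists [set v]%SET, (link e v); split=> //.
- by apply/set0Pn; exists v; rewrite finset.in_set1.
- by apply/set0Pn; exists v'; rewrite finset.in_set.
- by rewrite disjoints1 finset.in_set e_irr.
- by move=> a b; rewrite finset.in_set1 => /eqP->; rewrite finset.in_set.
Qed.

Lemma edge_join v v' : e v v' -> is_join e [set v; v']%SET.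
Proof.
move=> vv'; exists [set v]%SET, [set v']%SET; split=> //.
- by apply/set0Pn; exists v; rewrite finset.in_set1.
- by apply/set0Pn; exists v'; rewrite finset.in_set1.
- rewrite disjoints1 finset.in_set1; apply/eqP => vE.
  by move: vv'; rewrite vE e_irr.
- by move=> a b; rewrite !finset.in_set1 => /eqP-> /eqP->.
Qed.

Lemma edge_sub_star v v' : e v v' ->
  [set v; v']%SET \subset star e v /\ [set v; v']%SET \subset star e v'.
Proof.
by move=> vv'; split; apply/fintype.subsetP => x; rewrite !inE => /orP[] /eqP->;
  rewrite ?eqxx ?vv' ?orbT // e_sym vv' orbT.
Qed.

Lemma join_edge L : is_join e L ->
  exists v v', e v v' /\ [set v; v']%SET \subset L.
Proof.
move=> [A [B [/set0Pn[a aA] /set0Pn[b bB] _ -> AB]]]; exists a, b.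
split; first exact: AB.
by apply/fintype.subsetP => x; rewrite !inE => /orP[] /eqP->; rewrite ?aA ?bB ?orbT.
Qed.

Lemma max_join_ex L : is_join e L -> exists2 M, is_max_join e M & L \subset M.
Proof.
move=> jL; have [|M /maxsetP[/asboolP jM maxM] LM] :=
  @maxset_exists _ (fun L => `[< is_join e L >]) L; first exact/asboolP.
by exists M => //; split=> // M' jM' MM'; apply: maxM => //; exact/asboolP.
Qed.

(** * The coned-off Cayley graph *)

Section ConedOff.
Variable S : set (raag e).
Hypothesis S_fin : finite_set S.

Let HH := join_subgroups e.
Let X : choiceType := (raag e + left_cosets HH)%type.
Let E : X -> X -> Prop := skeleton (graph_complex (coned_off_edge S (HH := HH))).

Lemma coned_off_sym : symmetric (coned_off_edge S (HH := HH)).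
Proof.
by case=> [g|C] [h|C'] //=; apply: asbool_equiv_eq; rewrite or_comm.
Qed.

Let E_edge x y : coned_off_edge S (HH := HH) x y -> E x y.
Proof. by move=> xy; apply/(graph_skeletonP _ _ coned_off_sym); right. Qed.

Let Erefl x : E x x. Proof. exact: skeleton_refl. Qed.
Let Esym x y : E x y -> E y x. Proof. exact: skeleton_sym. Qed.

Lemma join_cosetP (C : left_cosets HH) : exists g L,
  is_join e L /\ val C = left_coset g (raag_sub L).
Proof.
have /set_mem[g [H [[L jL <-] ->]]] := valP C.
by exists g, L.
Qed.

Lemma coset_walk (C : left_cosets HH) g h : val C g -> val C h ->
  walk E 2 (inl g) (inl h).
Proof.
move=> Cg Ch; exists (inr C : X); first by apply: E_edge; apply/asboolP.
by apply: walk1; apply: E_edge; apply/asboolP.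
Qed.

Lemma coned_off_star v g h : raag_sub (star e v) (g^-1 * h) ->
  walk E 2 (inl g) (inl h).
Proof.
move=> gh; have CHH : left_cosets HH (left_coset g (raag_sub (star e v))).
  exists g, (raag_sub (star e v)); split=> //.
  by exists (star e v) => //; exact: star_join.
apply: (@coset_walk (SigSub (mem_set CHH))); apply/left_cosetP => //.
by rewrite mulVg; exact: raag_sub1.
Qed.

Lemma coned_off_word g w : walk E (2 * size w) (inl g) (inl (g * raag_word e w)).
Proof.
elim: w g => [|z w IHw] g; first by rewrite raag_word_nil mulg1.
rewrite mulnS; apply: (walk_cat (y := inl (g * raag_word e [:: z]) : X)).
  apply: (@coned_off_star z.1); rewrite mulKg; apply: raag_sub_letter.
  by rewrite !inE eqxx.
by rewrite (raag_word_cons e z w) mulgA; exact: IHw.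
Qed.

Let pick_elt (C : left_cosets HH) : exists g, val C g.
Proof.
have [g [L [_ ->]]] := join_cosetP C; exists g; apply/left_cosetP.
by rewrite mulVg; exact: raag_sub1.
Qed.

(** Cone vertices are rounded to a chosen element of their coset. *)
Let s (x : X) : raag e :=
  match x with inl g => g | inr C => projT1 (cid (pick_elt C)) end.

Let s_coset C : val C (s (inr C)).
Proof. by rewrite /=; case: cid. Qed.

(** Finitely many elements have bounded length in the standard generators. Inverses are included
    because the edges of the coned-off graph are unoriented. *)
Lemma generator_bound : exists M, forall g, S g \/ S g^-1 ->
  exists2 w, g = raag_word e w & (size w <= M)%N.
Proof.
have /finite_seqP[r rE] := S_fin.
pose f g := projT1 (cid (raag_word_surj g)).
have fE g : g = raag_word e (f g) by rewrite /f; case: cid.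
exists (\max_(g <- r) (size (f g) + size (f g^-1)))%N => g Sg; exists (f g) => //.
have bd h : S h -> (size (f h) + size (f h^-1) <=
    \max_(g <- r) (size (f g) + size (f g^-1)))%N.
  rewrite rE /= => hr.
  exact: (@leq_bigmax_seq _ r xpredT (fun g => size (f g) + size (f g^-1))%N).
by case: Sg => /bd; rewrite ?invgK; lia.
Qed.

Lemma coned_off_layers : exists (conn : forall x y, exists n, walk E n x y) (D : nat),
  forall x0, layers_bounded conn D x0.
Proof.
have [M MP] := generator_bound.
(* A standard letter costs 2, by way of a cone vertex, and an edge given by [S] spells at most [M]
   letters; [M.+1] ensures [2 <= c]. *)
have [c cM] : exists c, (2 * M.+1 <= c)%N by exists (2 * M.+1)%N.
have c2 : (2 <= c)%N by lia.
have c1 : (1 <= c)%N by lia.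
have p_star v g h : raag_sub (star e v) (g^-1 * h) -> walk E c (inl g) (inl h).
  by move=> /coned_off_star; exact: walk_le.
have p_s x : walk E c x (inl (s x)).
  case: x => [g|C]; first exact: walk_idle.
  apply: (walk_le Erefl c1); apply: walk1; apply: E_edge; apply/asboolP.
  exact: s_coset.
have s_edge x y : E x y -> exists w, s y = s x * raag_word e w /\
    forall u t, w = u ++ t -> walk E c x (inl (s x * raag_word e u)).
  have in_coset (C : left_cosets HH) g h : val C g -> val C h ->
      exists w, h = g * raag_word e w /\
      forall u t, w = u ++ t -> val C (g * raag_word e u).
    by have [k [L [_ ->]]] := join_cosetP C; exact: left_coset_path.
  move=> /(graph_skeletonP _ _ coned_off_sym)[<-|].
    exists [::]; rewrite raag_word_nil mulg1; split=> // -[|//] t _.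
    by rewrite raag_word_nil mulg1.
  case: x y => [g|C] [h|C'] //= /asboolP.
  - move=> gh; have [|w ghw wM] := MP (g^-1 * h); first by rewrite invgM invgK.
    exists w; rewrite -ghw mulVKg; split=> // u t wE.
    apply: (walk_le Erefl (m := (2 * size u)%N)); last exact: coned_off_word.
    by move: wM; rewrite wE size_cat; lia.
  - move=> C'g; have [w [wE wP]] := in_coset C' g _ C'g (s_coset C').
    exists w; split=> // u t /wP C'u.
    exact: (walk_le Erefl c2 (coset_walk C'g C'u)).
  - move=> Ch; have [w [wE wP]] := in_coset C _ h (s_coset C) Ch.
    exists w; split=> // u t /wP Cu.
    by apply: (walk_le Erefl c1); apply: walk1; apply: E_edge; apply/asboolP.
exists (coarse_connected Esym p_star p_s), (13 * c)%N => x0 x y.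
exact: (coarse_layer_bound e_sym e_irr Erefl s_edge).
Qed.

End ConedOff.

(** * The intersection complex *)

Section IntersectionComplex.
Let X := max_product_subcomplex (e := e).
Let E : X -> X -> Prop := skeleton (intersection_complex e).

Let Erefl x : E x x. Proof. exact: skeleton_refl. Qed.
Let Esym x y : E x y -> E y x. Proof. exact: skeleton_sym. Qed.

Lemma max_product_ex g L : is_max_join e L -> max_product_subcomplex (std_subcomplex g L).
Proof. by exists g, L. Qed.

Definition max_product g L (mL : is_max_join e L) : X :=
  SigSub (mem_set (max_product_ex g mL)).

Lemma max_product_eq g h L (mL : is_max_join e L) : raag_sub L (g^-1 * h) ->
  max_product g mL = max_product h mL.
Proof. by move=> gh; apply/val_inj; exact: std_subcomplex_eq. Qed.

Lemma max_productP (P : X) : exists g L (mL : is_max_join e L), P = max_product g mL.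
Proof.
have /set_mem[g [L [mL PE]]] := valP P; exists g, L, mL.
exact/val_inj.
Qed.

Lemma max_product_vertex g L (mL : is_max_join e L) h :
  val (max_product g mL) [set h] -> max_product g mL = max_product h mL.
Proof. by move=> /std_subcomplex_vertex; exact: max_product_eq. Qed.

Lemma max_product_adj g K L L' (mL : is_max_join e L) (mL' : is_max_join e L') :
  is_join e K -> K \subset L -> K \subset L' -> E (max_product g mL) (max_product g mL').
Proof.
move=> jK KL KL'; split; [exact: finite_set2|by exists (max_product g mL); left|].
exists (std_subcomplex g K); first by exists g, K.
by move=> c cK P [->|->]; apply: std_subcomplexS cK.
Qed.

(** A simple path in the defining graph has fewer than [#|V|] edges; two more steps attach the given
    products. *)
Let c0 := (#|V|.+2)%N.

(** Choose a maximal join around each star. For adjacent vertices these joins share an edge, so a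
    path in the defining graph yields a walk of products through [g]; any maximal join contains an
    edge and is thus adjacent to a chosen one. *)
Lemma max_product_walk g L L' (mL : is_max_join e L) (mL' : is_max_join e L') :
  walk E c0 (max_product g mL) (max_product g mL').
Proof.
have M v := cid2 (max_join_ex (star_join v)).
pose m v : X := max_product g (s2valP (M v)).
have edge v v' : e v v' -> E (m v) (m v').
  move=> vv'; have [s1 s2] := edge_sub_star vv'.
  apply: (@max_product_adj g [set v; v']%SET); first exact: edge_join.
    exact: (fintype.subset_trans s1 (s2valP' (M v))).
  exact: (fintype.subset_trans s2 (s2valP' (M v'))).
have near K (mK : is_max_join e K) : exists v, E (max_product g mK) (m v).
  have [v [v' [vv' vK]]] := join_edge mK.1; exists v.
  apply: (@max_product_adj g [set v; v']%SET) => //; first exact: edge_join.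
  by have [s1 _] := edge_sub_star vv'; exact: (fintype.subset_trans s1 (s2valP' (M v))).
have [a La] := near _ mL; have [b Lb] := near _ mL'.
exists (m a) => //; rewrite -addn1; apply: walk_cat (walk1 (Esym Lb)).
have /connectP[q] := e_connected a b; case/shortenP => q' aq' uq' _ ->.
apply: (walk_le Erefl (m := size q')).
  by have := max_card (mem (a :: q')); rewrite (card_uniqP uq') /=; lia.
elim: q' a {uq' La} aq' => [//|a' q' IHq] a /= /andP[/edge aa' /IHq a'q'].
by exists (m a').
Qed.

(** All products in the simplex contain the vertex [k], so each is determined by its join
    subgraph. *)
Lemma inter_simplex_cover (s : set X) : simplex (intersection_complex e) s ->
  exists2 r : seq X, (size r <= #|{set V}|)%N & s `<=` [set` r].
Proof.
move=> [_ [P0 _] [_ [k [K [jK ->]]] Ks]].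
(* [P0] is a dummy value for the sets that are not maximal joins. *)
pose f L : X := if pselect (is_max_join e L) is left mL then max_product k mL else P0.
exists [seq f L | L <- enum {set V}]; first by rewrite size_map -cardE.
move=> P sP /=; have [g [L [mL PE]]] := max_productP P; apply/mapP.
exists L; first by rewrite mem_enum.
rewrite /f; case: pselect => // mL'; rewrite (Prop_irrelevance mL' mL) PE.
apply: max_product_vertex; rewrite -PE; apply: (Ks _ _ _ sP).
by apply/std_subcomplex_vertex; rewrite mulVg; exact: raag_sub1.
Qed.

Lemma max_product_inhabited : exists L, is_max_join e L.
Proof.
by have [x _] := e_edge; have [L mL _] := max_join_ex (star_join x); exists L.
Qed.

Lemma intersection_layers : exists (conn : forall x y, exists n, walk E n x y) (D : nat),
  forall x0, layers_bounded conn D x0.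
Proof.
have [L0 mL0] := max_product_inhabited.
pose p g : X := max_product g mL0.
pose s P := projT1 (cid (max_productP P)).
have sP P : exists L (mL : is_max_join e L), P = max_product (s P) mL.
  by rewrite /s; case: cid.
(* Twice [c0]: from [p g] to a maximal product containing the coset of [A(star v)], and from there
   to [p h]. *)
have [c cE] : exists c, c = (c0 + c0)%N by exists (c0 + c0)%N.
have c0c : (c0 <= c)%N by rewrite cE; lia.
have c1c : (c0.+1 <= c)%N by rewrite cE /c0; lia.
have p_star v g h : raag_sub (star e v) (g^-1 * h) -> walk E c (p g) (p h).
  move=> gh; have [M mM vM] := max_join_ex (star_join v).
  rewrite cE; apply: (walk_cat (y := max_product g mM)); first exact: max_product_walk.
  rewrite (max_product_eq (h := h)); first exact: max_product_walk.
  exact: raag_subS gh.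
have near (P : X) g : val P [set g] -> walk E c0 P (p g).
  have [k [L [mL ->]]] := max_productP P => /max_product_vertex ->.
  exact: max_product_walk.
have sPv (P : X) : val P [set (s P)].
  have [L [mL PE]] := sP P; rewrite {1}PE; apply/std_subcomplex_vertex.
  by rewrite mulVg; exact: raag_sub1.
have p_s P : walk E c P (p (s P)).
  by apply: (walk_le Erefl c0c); apply: near; exact: sPv.
have inP (P : X) g h : val P [set g] -> val P [set h] ->
    exists w, h = g * raag_word e w /\
    forall u t, w = u ++ t -> val P [set (g * raag_word e u)].
  have [k [L [mL ->]]] := max_productP P.
  move=> /std_subcomplex_vertex/left_cosetP kg /std_subcomplex_vertex/left_cosetP kh.
  have [w [hE wP]] := left_coset_path kg kh; exists w; split=> // u t /wP ku.
  exact/std_subcomplex_vertex/left_cosetP.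
have s_edge x y : E x y -> exists w, s y = s x * raag_word e w /\
    forall u t, w = u ++ t -> walk E c x (p (s x * raag_word e u)).
  move=> /[dup] xy [_ _ [_ [k [K [jK ->]]] Ks]].
  have kK : std_subcomplex k K [set k].
    by apply/std_subcomplex_vertex; rewrite mulVg; exact: raag_sub1.
  (* Travel from [s x] inside [x] to the common vertex [k], then inside [y] to [s y]. *)
  have [w1 [w1E w1P]] := inP x _ _ (sPv x) (Ks _ kK x (or_introl erefl)).
  have [w2 [w2E w2P]] := inP y _ _ (Ks _ kK y (or_intror erefl)) (sPv y).
  exists (w1 ++ w2); split; first by rewrite raag_word_cat mulgA -w1E.
  move=> u t /esym/eq_cat_prefix[[r /w1P xu]|[r [-> /w2P yr]]].
    by apply: (walk_le Erefl c0c); exact: near.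
  (* Prefixes beyond [k] lie in [y], which is adjacent to [x]: hence one step more than [c0]. *)
  apply: (walk_le Erefl c1c); exists y => //.
  by apply: near; rewrite raag_word_cat mulgA -w1E.
exists (coarse_connected Esym p_star p_s), (13 * c)%N => x0 x y.
exact: (coarse_layer_bound e_sym e_irr Erefl s_edge).
Qed.

End IntersectionComplex.

Lemma raag_generated :
  finite_generating [set raag_gen e v | v in [set: V]].
Proof.
split; first by apply: finite_image; exact: finite_finset.
apply/seteqP; split=> // g _; have := raag_subT g.
rewrite /raag_sub; congr (gen _ _); apply/seteqP; split=> _ [v _ <-]; exists v => //=.
Qed.

End Joins.

Theorem theorem7 (R : realType) (V : finType) (e : rel V)
  (e_sym : symmetric e) (e_irr : irreflexive e)
  (e_connected : forall x y : V, connect e x y)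
  (e_triangle_free : forall x y z : V, ~ [/\ e x y, e y z & e x z])
  (e_edge : exists x y : V, e x y) :
  quasi_tree (@path_dist R _ (intersection_complex e)) /\
  weakly_hyperbolic R (join_subgroups e).
Proof.
split.
  have [conn [D bd]] := intersection_layers e_sym e_irr e_connected e_edge.
  have [L0 mL0] := max_product_inhabited e_irr e_connected e_edge.
  apply: (quasi_tree_of_layers _ _ (bd (max_product 1 mL0)));
    last exact: (bounded_slope (inter_simplex_cover (e := e))).
  (* The Lipschitz constant is twice the number of subsets of [V]; as a quasi-isometry constant it
     has to be at least 1. *)
  have : (0 < #|{set V}|)%N by apply/card_gt0P; exists finset.set0.
  by rewrite -(ler_nat R); lra.
split.
- by apply: finite_image; exact: finite_finset.
- by move=> _ [L _ <-]; exact: raag_sub_subgroup.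
- by exists [set raag_gen e v | v in [set: V]]; exact: raag_generated.
- move=> S [S_fin _].
  have [conn [D bd]] := coned_off_layers e_sym e_irr e_connected e_edge S_fin.
  exact: hyperbolic_of_layers bd.
Qed.
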